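(* Let $n\ge 5$ and let $K$ and $L$ be two star bodies in $\mathbb{R}^n$, each having countably many diameters. Assume that there exists a direction $\zeta\in S^{n-1}$ such that $K$ has a diameter $d_K(\zeta)$ parallel to $\zeta$ and containing the origin, and such that, for every four dimensional linear subspace $H$ of $\mathbb{R}^n$ containing $\zeta$, the sections $K\cap H$ and $L\cap H$ are directly congruent. Assume also that, for every such $H$, the sections $K\cap H$ and $L\cap H$ have no $SO(4)$ symmetries, and the three dimensional sections $K\cap(H\cap\zeta^\perp)$ and $L\cap(H\cap\zeta^\perp)$ have no $O(3)$ symmetries. Then $K=L+b$ or $K=-L+b$ for some $b\in\mathbb{R}^n$ parallel to $\zeta$.
   Context: A body is a compact set which is equal to the closure of its non-empty interior. A set $S\subset\mathbb{R}^n$ is star-shaped with respect to an interior point $p$ if the segment from $p$ to any point of $S$ is contained in $S$. For a nonempty compact set $K$ that is star-shaped with respect to the origin, the radial function is $\rho_K(x)=\max\{c: cx\in K\}$, $x\in\mathbb{R}^n\setminus\{0\}$. A star body is a body that is star-shaped with respect to the origin and whose radial function is continuous. A segment $[z,y]\subset K$ is a diameter of the star body $K$ if $|z-y|=\max_{[a,b]\subset K}|a-b|$; ''countably many diameters'' means that the set of diameters is countable (possibly finite). If $K$ has a diameter parallel to $\zeta$ containing the origin, it is denoted $d_K(\zeta)$. $\zeta^\perp$ is the hyperplane through the origin orthogonal to $\zeta$. Here $O(k,H)$ and $SO(k,H)$ denote the orthogonal and special orthogonal groups of a $k$ dimensional subspace $H$. Two subsets $D,B$ of a $k$ dimensional subspace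 $H$ are directly congruent if $\varphi(D)=B+a$ for some $a\in H$ and some $\varphi\in SO(k,H)$. A set $D\subset H$ has an $SO(k)$ symmetry (respectively, an $O(k)$ symmetry) if $\varphi(D)=D+a$ for some $a\in H$ and some non-identity $\varphi\in SO(k,H)$ (respectively, $\varphi\in O(k,H)$). ''Parallel to $\zeta$'' means a real scalar multiple of $\zeta$ (possibly zero). *)

(* Defs.v *)
(* MathComp / MathComp-Analysis; R^n is 'rV[R]_n over R : realType. *)
From HB Require Import structures.
From mathcomp Require Export all_boot all_order all_algebra.
From mathcomp Require Export all_classical all_reals all_analysis.
Export Order.TTheory GRing.Theory Num.Theory.
Export numFieldNormedType.Exports.

Set Implicit Arguments.
Unset Strict Implicit.
Unset Printing Implicit Defensive.

Local Open Scope classical_set_scope.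
Local Open Scope ring_scope.

(* The library norm on matrices is the sup norm; it induces the Euclidean
   topology, but lengths and orthogonality below use dotrv and enorm. *)
Definition dotrv (R : realType) (n : nat) (x y : 'rV[R]_n) : R :=
  \sum_(i < n) x 0 i * y 0 i.

Definition enorm (R : realType) (n : nat) (x : 'rV[R]_n) : R :=
  Num.sqrt (dotrv x x).

Definition segment (R : realType) (n : nat) (a b : 'rV[R]_n) : set 'rV[R]_n :=
  [set (1 - t) *: a + t *: b | t in [set t : R | 0 <= t <= 1]].

Definition translate (R : realType) (n : nat) (D : set 'rV[R]_n)
    (a : 'rV[R]_n) : set 'rV[R]_n :=
  [set x + a | x in D].

Definition reflect0 (R : realType) (n : nat) (D : set 'rV[R]_n) :
    set 'rV[R]_n :=
  [set - x | x in D].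

Definition parallel (R : realType) (n : nat) (x zeta : 'rV[R]_n) : Prop :=
  exists c : R, x = c *: zeta.

Definition is_body (R : realType) (n : nat) (K : set 'rV[R]_n) : Prop :=
  [/\ compact K, interior K !=set0 & K = closure (interior K)].

(* The center p is required to be an interior point of S. *)
Definition star_shaped (R : realType) (n : nat) (S : set 'rV[R]_n)
    (p : 'rV[R]_n) : Prop :=
  interior S p /\ forall x, S x -> segment p x `<=` S.

(* For x != 0 and K compact containing the origin, the supremum is attained,
   hence is a maximum. *)
Definition radial (R : realType) (n : nat) (K : set 'rV[R]_n)
    (x : 'rV[R]_n) : R :=
  sup [set c : R | K (c *: x)].

Definition star_body (R : realType) (n : nat) (K : set 'rV[R]_n) : Prop :=
  [/\ is_body K, star_shaped K 0 &
      {within [set x : 'rV[R]_n | x != 0], continuous (radial K)}].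

Definition is_diameter (R : realType) (n : nat) (K : set 'rV[R]_n)
    (z y : 'rV[R]_n) : Prop :=
  segment z y `<=` K /\
  forall a b, segment a b `<=` K -> enorm (a - b) <= enorm (z - y).

(* Diameters are collected as segments (point sets), so that exchanging the
   two endpoints does not give a different diameter. *)
Definition diameters (R : realType) (n : nat) (K : set 'rV[R]_n) :
    set (set 'rV[R]_n) :=
  [set D | exists z y, is_diameter K z y /\ D = segment z y].

Definition has_diameter_along (R : realType) (n : nat) (K : set 'rV[R]_n)
    (zeta : 'rV[R]_n) : Prop :=
  exists z y, [/\ is_diameter K z y, parallel (z - y) zeta & segment z y 0].

Definition orth_hyperplane (R : realType) (n : nat) (zeta : 'rV[R]_n) :
    {vspace 'rV[R]_n} :=
  lker (linfun (mulmxr zeta^T : 'rV[R]_n -> 'rV[R]_1)).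

Lemma mem_orth_hyperplane (R : realType) (n : nat) (zeta x : 'rV[R]_n) :
  (x \in orth_hyperplane zeta) = (dotrv x zeta == 0).
Proof.
rewrite memv_ker lfunE /=; apply/eqP/eqP => [/matrixP/(_ 0 0)|h].
  by rewrite !mxE => <-; apply: eq_bigr => i _; rewrite mxE.
apply/matrixP => i j; rewrite !ord1 !mxE -[RHS]h.
by apply: eq_bigr => k _; rewrite mxE.
Qed.

Definition section_by (R : realType) (n : nat) (K : set 'rV[R]_n)
    (H : {vspace 'rV[R]_n}) : set 'rV[R]_n :=
  K `&` [set x | x \in H].

(* Elements of O(k, H), k = dim H, are endomorphisms of the space H itself
   (the type subvs_of H), not of R^n. *)
Definition is_O (R : realType) (n : nat) (H : {vspace 'rV[R]_n})
    (phi : 'End(subvs_of H)) : Prop :=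
  forall u v, dotrv (vsval (phi u)) (vsval (phi v)) = dotrv (vsval u) (vsval v).

(* The determinant of an endomorphism is that of its matrix in any basis;
   vbasis is the library's chosen one. *)
Definition det_end (R : realType) (V : vectType R) (phi : 'End(V)) : R :=
  \det (passmx.mxof (vbasis {:V}) (vbasis {:V}) phi).

Definition is_SO (R : realType) (n : nat) (H : {vspace 'rV[R]_n})
    (phi : 'End(subvs_of H)) : Prop :=
  is_O phi /\ det_end phi = 1.

(* phi(D) for D contained in H. *)
Definition image_in (R : realType) (n : nat) (H : {vspace 'rV[R]_n})
    (phi : 'End(subvs_of H)) (D : set 'rV[R]_n) : set 'rV[R]_n :=
  [set vsval (phi u) | u in [set u : subvs_of H | D (vsval u)]].

Definition directly_congruent (R : realType) (n : nat)
    (H : {vspace 'rV[R]_n}) (D B : set 'rV[R]_n) : Prop :=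
  exists (phi : 'End(subvs_of H)) (a : 'rV[R]_n),
    [/\ is_SO phi, a \in H & image_in phi D = translate B a].

Definition has_SO_symmetry (R : realType) (n : nat)
    (H : {vspace 'rV[R]_n}) (D : set 'rV[R]_n) : Prop :=
  exists (phi : 'End(subvs_of H)) (a : 'rV[R]_n),
    [/\ is_SO phi, phi <> \1%VF, a \in H & image_in phi D = translate D a].

Definition has_O_symmetry (R : realType) (n : nat)
    (H : {vspace 'rV[R]_n}) (D : set 'rV[R]_n) : Prop :=
  exists (phi : 'End(subvs_of H)) (a : 'rV[R]_n),
    [/\ is_O phi, phi <> \1%VF, a \in H & image_in phi D = translate D a].

(* Main.v *)
Require Import Defs.
From HB Require Import structures.
From mathcomp Require Import ring lra.

(** Why the theorem holds.

    Write [e] for the direction of [zeta], and work inside a five-dimensional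
    space spanned by an orthonormal frame [B] whose first row is [zeta]; the
    four-dimensional subspaces of it that contain [zeta] are the [w^perp], with
    [w] a unit vector orthogonal to [e].  By hypothesis some rotation [P] of
    [w^perp], followed by a translation, carries the section of [K] to that of
    [L].

    The diameters pin [P] down on the axis.  The chord of [K] along [zeta] is
    a diameter of length [d], its image is a chord of [L] of length [d], and no
    chord of [L] is longer since every chord lies in some section
    ([chord_le5]).  Hence the image is a diameter of [L].  A diameter that is
    not on the axis lies in [w^perp] only for finitely many [w] on a suitable
    curve, and there are countably many diameters, so for a dense set of [w]
    the image lies on the axis ([generic_dense]).  For those [w],
    [e P = ep e] with [ep = 1] or [ep = -1], and the translation is along
    [zeta], determined by [ep] ([generic_motion]).  Because the radial
    functions are continuous, this normal form is a closed condition on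
    [(w, P)] ([closed_motion_graph]), so by compactness of the orthogonal group
    it is available for every [w] ([motion_exists]).  Two such [P] for the
    same [w] differ by a rotational symmetry of the section of [K], so [P] is
    unique ([motion_unique]); it follows that [P] depends continuously on [w].

    It remains to see that [K] and [L] agree, up to the translation and the
    sign [ep], on every plane [span (e, x)] with [x] a unit vector orthogonal
    to [e].  It suffices to find one [w] orthogonal to [e] and [x] for which
    [x P = ep x].  Let [w] run over a two-sphere orthogonal to [e] and [x].
    On the plane orthogonal to [e], [x] and [w] the quadratic form
    [u |-> <u P, u>] is a multiple of the square of the length only if
    [x P = ep x], by a computation with three-dimensional rotations
    ([umbilic_fix]).  And a continuous family of quadratic forms on the tangent
    planes of a two-sphere, equal at antipodes, must be such a multiple
    somewhere ([umbilic_exists]).  Otherwise its trace-free part would be a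
    nowhere zero complex function on a hemisphere, so it would have winding
    number [0] along the equator, but the symmetry under the antipode forces
    winding number [2].

    The sign [ep] does not change along the two-sphere.  Any two points of the
    whole space lie in a common five-dimensional space in which some [w] is
    orthogonal to both, so they are governed by the same sign ([two_points] in
    the proof of the theorem), and one sign works for all points at once. *)

Set Implicit Arguments.
Unset Strict Implicit.
Unset Printing Implicit Defensive.

Local Open Scope classical_set_scope.
Local Open Scope ring_scope.

(** * Orthonormal systems of row vectors *)

Section Dot.
Variable R : realType.

Lemma dotrvE n (x y : 'rV[R]_n) : dotrv x y = (x *m y^T) 0 0.
Proof. by rewrite mxE; apply: eq_bigr => i _; rewrite mxE. Qed.

Lemma mulmx_tr_dotrv n (x y : 'rV[R]_n) : x *m y^T = (dotrv x y)%:M.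
Proof. by rewrite dotrvE -mx11_scalar. Qed.

Lemma dotrvC n (x y : 'rV[R]_n) : dotrv x y = dotrv y x.
Proof. by apply: eq_bigr => i _; rewrite mulrC. Qed.

Lemma dotrvDl n (x y z : 'rV[R]_n) : dotrv (x + y) z = dotrv x z + dotrv y z.
Proof. by rewrite !dotrvE mulmxDl mxE. Qed.

Lemma dotrvZl n c (x z : 'rV[R]_n) : dotrv (c *: x) z = c * dotrv x z.
Proof. by rewrite !dotrvE -scalemxAl mxE. Qed.

Lemma dotrvNl n (x z : 'rV[R]_n) : dotrv (- x) z = - dotrv x z.
Proof. by rewrite -scaleN1r dotrvZl mulN1r. Qed.

Lemma dotrvDr n (x y z : 'rV[R]_n) : dotrv z (x + y) = dotrv z x + dotrv z y.
Proof. by rewrite !(dotrvC z) dotrvDl. Qed.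

Lemma dotrvZr n c (x z : 'rV[R]_n) : dotrv z (c *: x) = c * dotrv z x.
Proof. by rewrite !(dotrvC z) dotrvZl. Qed.

Lemma dotrv0 n (x : 'rV[R]_n) : dotrv 0 x = 0.
Proof. by rewrite dotrvE mul0mx mxE. Qed.

Lemma dotrv_ge0 n (x : 'rV[R]_n) : 0 <= dotrv x x.
Proof. by apply: sumr_ge0 => i _; rewrite -expr2 sqr_ge0. Qed.

Lemma dotrv_eq0 n (x : 'rV[R]_n) : dotrv x x = 0 -> x = 0.
Proof.
move=> /eqP; rewrite psumr_eq0 => [/allP x0|i _]; last by rewrite -expr2 sqr_ge0.
apply/rowP => i; rewrite mxE; apply/eqP.
by have := x0 i (mem_index_enum i); rewrite /= mulf_eq0 orbb.
Qed.

Lemma dotrv_mul_tr n (T : 'M[R]_n) (x y : 'rV[R]_n) :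
  dotrv (x *m T) y = dotrv x (y *m T^T).
Proof. by rewrite !dotrvE trmx_mul trmxK mulmxA. Qed.

Lemma dotrv_mul k n (A : 'M[R]_(k, n)) (x y : 'rV[R]_k) :
  A *m A^T = 1%:M -> dotrv (x *m A) (y *m A) = dotrv x y.
Proof.
by move=> AA; rewrite !dotrvE trmx_mul mulmxA -(mulmxA x) AA mulmx1.
Qed.

Lemma enorm_mul k n (A : 'M[R]_(k, n)) (x : 'rV[R]_k) :
  A *m A^T = 1%:M -> enorm (x *m A) = enorm x.
Proof. by move=> AA; rewrite /enorm dotrv_mul. Qed.

Lemma enormZ n c (x : 'rV[R]_n) : enorm (c *: x) = `|c| * enorm x.
Proof.
rewrite /enorm dotrvZl dotrvZr mulrA -expr2 sqrtrM ?sqr_ge0//.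
by rewrite sqrtr_sqr.
Qed.

(** The residual of [p] after projection is normalised; if it vanishes, any unit
    vector of the kernel of [A^T] will do. *)
Lemma orthonormal_step k n (A : 'M[R]_(k, n)) (p : 'rV[R]_n) :
  A *m A^T = 1%:M -> (k < n)%N ->
  exists v : 'rV[R]_n, [/\ v *m v^T = 1%:M, A *m v^T = 0
    & exists (x : 'rV[R]_k) (c : R), p = x *m A + c *: v].
Proof.
move=> AA kn.
have normalise (u : 'rV[R]_n) : A *m u^T = 0 -> u != 0 ->
    exists v : 'rV[R]_n, [/\ v *m v^T = 1%:M, A *m v^T = 0
      & exists c, u = c *: v].
  move=> Au u0; have uu : 0 < dotrv u u.
    rewrite lt_neqAle dotrv_ge0 andbT eq_sym.
    by apply: contra_neq u0 => /dotrv_eq0.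
  have su : Num.sqrt (dotrv u u) != 0 by rewrite gt_eqF// sqrtr_gt0.
  exists ((Num.sqrt (dotrv u u))^-1 *: u); split.
  - rewrite mulmx_tr_dotrv dotrvZl dotrvZr mulrA -expr2 exprVn sqr_sqrtr ?ltW//.
    by rewrite mulVf ?gt_eqF.
  - by rewrite linearZ/= -scalemxAr Au scaler0.
  - by exists (Num.sqrt (dotrv u u)); rewrite scalerA mulfV// scale1r.
have [pA|pA] := eqVneq (p - p *m A^T *m A) 0.
  have [u [Au u0]] : exists u : 'rV[R]_n, A *m u^T = 0 /\ u != 0.
    have : kermx A^T != 0.
      rewrite kermx_eq0 /row_free mxrank_tr; apply/eqP => rA.
      by have := rank_leq_row A; rewrite rA leqNgt kn.
    case/rowV0Pn => u /sub_kermxP uA u0; exists u; split => //.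
    by apply: trmx_inj; rewrite trmx_mul trmxK trmx0.
  have [v [vv Av _]] := normalise u Au u0.
  exists v; split => //; exists (p *m A^T), 0.
  by rewrite scale0r addr0; apply/eqP; rewrite -subr_eq0 pA.
have Au : A *m (p - p *m A^T *m A)^T = 0.
  apply: trmx_inj; rewrite trmx0 trmx_mul trmxK mulmxBl.
  by rewrite -(mulmxA _ A) AA mulmx1 subrr.
have [v [vv Av [c pc]]] := normalise _ Au pA.
by exists v; split => //; exists (p *m A^T), c; rewrite -pc addrC subrK.
Qed.

(** Gram-Schmidt: the prescribed rows of [P] are absorbed one by one, so that a
    frame can be chosen to contain given vectors in its span. *)
Lemma orthonormal_extend m : forall k n (A : 'M[R]_(k, n)) (P : 'M[R]_(m, n)),
  A *m A^T = 1%:M -> (k + m <= n)%N ->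
  exists C : 'M[R]_(m, n), [/\ C *m C^T = 1%:M, A *m C^T = 0
    & exists X Y, P = X *m A + Y *m C].
Proof.
elim: m => [|m IH] k n A P AA kmn.
  exists 0; split; first by apply/matrixP => -[].
    by apply/matrixP => i [].
  by exists 0, 0; apply/matrixP => -[].
rewrite -(add1n m) in P kmn *.
have kn : (k < n)%N by apply: leq_trans kmn; rewrite add1n addnS ltnS leq_addr.
have [v [vv Av [x [c pc]]]] :=
  orthonormal_step (usubmx P) AA kn.
have vA : v *m A^T = 0 by apply: trmx_inj; rewrite trmx_mul trmxK Av trmx0.
have AvO : col_mx A v *m (col_mx A v)^T = 1%:M.
  by rewrite tr_col_mx mul_col_row AA Av vA vv -scalar_mx_block.
have [|C [CC AC [X [Y PC]]]] :=
  IH (k + 1)%N n (col_mx A v) (dsubmx P) AvO.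
  by rewrite -addnA.
move: AC; rewrite mul_col_mx => /eqP; rewrite col_mx_eq0 => /andP[/eqP AC /eqP vC].
have Cv : C *m v^T = 0 by apply: trmx_inj; rewrite trmx_mul trmxK vC trmx0.
exists (col_mx v C : 'M[R]_(1 + m, n)); split.
- by rewrite tr_col_mx mul_col_row vv CC vC Cv -scalar_mx_block.
- by rewrite tr_col_mx mul_mx_row Av AC row_mx0.
exists (col_mx x (lsubmx X)).
exists (block_mx c%:M 0 (rsubmx X) Y).
rewrite mul_col_mx mul_block_col mul0mx addr0 add_col_mx.
rewrite -[LHS](vsubmxK P) pc PC mul_scalar_mx; congr col_mx.
by rewrite -{1}[X]hsubmxK mul_row_col addrA.
Qed.
End Dot.

(** * Congruences of sections as matrices *)

Import passmx.

Section Frame.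
Variables (R : realType) (k n : nat) (A : 'M[R]_(k, n)).
Hypothesis AA : A *m A^T = 1%:M.

Definition rowvs : {vspace 'rV[R]_n} :=
  limg (linfun (mulmxr A : 'rV[R]_k -> 'rV[R]_n)).

Lemma mem_rowvs x : x \in rowvs <-> exists c : 'rV[R]_k, x = c *m A.
Proof.
split=> [/memv_imgP[c _ ->]|[c ->]]; first by exists c; rewrite lfunE.
by apply/memv_imgP; exists c; rewrite ?memvf// lfunE.
Qed.

Lemma mulmx_rowvs (c : 'rV[R]_k) : c *m A \in rowvs.
Proof. by apply/mem_rowvs; exists c. Qed.

Lemma mul_frameK (c : 'rV[R]_k) : c *m A *m A^T = c.
Proof. by rewrite -mulmxA AA mulmx1. Qed.

Lemma rowvsK x : x \in rowvs -> x *m A^T *m A = x.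
Proof. by move=> /mem_rowvs[c ->]; rewrite mul_frameK. Qed.

Lemma dim_rowvs : \dim rowvs = k.
Proof.
rewrite /rowvs limg_dim_eq ?dimvf /dim/= ?mul1n//.
apply/eqP; rewrite -subv0; apply/subvP => c.
rewrite memv_cap memvf/= memv_ker lfunE/= => /eqP c0.
by rewrite memv0 -(mul_frameK c) c0 mul0mx.
Qed.

Definition frame_emb (c : 'rV[R]_k) : subvs_of rowvs := vsproj rowvs (c *m A).

Definition frame_coord (u : subvs_of rowvs) : 'rV[R]_k := vsval u *m A^T.

Lemma vsval_emb c : vsval (frame_emb c) = c *m A.
Proof. by rewrite vsprojK// mulmx_rowvs. Qed.

Lemma frame_embK c : frame_coord (frame_emb c) = c.
Proof. by rewrite /frame_coord vsval_emb mul_frameK. Qed.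

Lemma frame_coordK u : frame_emb (frame_coord u) = u.
Proof. by apply: subvs_inj; rewrite vsval_emb rowvsK// subvsP. Qed.

Lemma frame_emb_linear : linear frame_emb.
Proof.
by move=> a x y; apply: subvs_inj; rewrite linearP/= !vsval_emb mulmxDl -scalemxAl.
Qed.
HB.instance Definition _ :=
  GRing.isLinear.Build R 'rV[R]_k (subvs_of rowvs) _ frame_emb frame_emb_linear.

Lemma frame_coord_linear : linear frame_coord.
Proof. by move=> a x y; rewrite /frame_coord linearP/= mulmxDl -scalemxAl. Qed.
HB.instance Definition _ :=
  GRing.isLinear.Build R (subvs_of rowvs) 'rV[R]_k _ frame_coord
    frame_coord_linear.

(** The matrix acts on the right on coordinate rows, as do all matrices below. *)
Definition frame_mx (phi : 'End(subvs_of rowvs)) : 'M[R]_k :=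
  lin1_mx (frame_coord \o phi \o frame_emb).

Lemma mul_frame_mx phi c : c *m frame_mx phi = frame_coord (phi (frame_emb c)).
Proof. by rewrite mul_rV_lin1. Qed.

Implicit Type phi : 'End(subvs_of rowvs).

Lemma vsval_frame_mx phi u :
  vsval (phi u) = frame_coord u *m frame_mx phi *m A.
Proof. by rewrite mul_frame_mx frame_coordK -vsval_emb frame_coordK. Qed.

Lemma dotrv_coord u v :
  dotrv (vsval u) (vsval v) = dotrv (frame_coord u) (frame_coord v).
Proof.
by rewrite -(dotrv_mul (frame_coord u) (frame_coord v) AA) !rowvsK ?subvsP.
Qed.

Definition frame_end (P : 'M[R]_k) : 'End(subvs_of rowvs) :=
  linfun (frame_emb \o mulmxr P \o frame_coord).

Lemma frame_endE P u : frame_end P u = frame_emb (frame_coord u *m P).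
Proof. by rewrite lfunE. Qed.

Lemma frame_endK P : frame_mx (frame_end P) = P.
Proof.
by apply/row_matrixP => i; rewrite !rowE mul_frame_mx frame_endE !frame_embK.
Qed.

(** Stated for a variable [d] because the two bases of the section have lengths
    [\dim] and [k], which are equal but not convertible. *)
Lemma det_intertwine (d : nat) (T : 'M[R]_d) (S : 'M[R]_(d, k)) (P : 'M[R]_k) :
  d = k -> row_free S -> T *m S = S *m P -> \det T = \det P.
Proof.
move=> dk; subst d; rewrite row_free_unit => Su TS.
apply: (mulIf (_ : \det S != 0)); first by rewrite -unitfE -unitmxE.
by rewrite -det_mulmx TS det_mulmx mulrC.
Qed.

(** The chosen basis of the subspace and the frame [A] differ by an invertible
    change of coordinates, which preserves the determinant. *)
Lemma det_end_frame phi : det_end phi = \det (frame_mx phi).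
Proof.
set b := vbasis {:subvs_of rowvs}.
have bb : basis_of {:subvs_of rowvs} b by exact: vbasisP.
pose S := lin1_mx (frame_coord \o vecof b).
apply: (@det_intertwine _ _ S).
- by rewrite dimvf -[RHS]dim_rowvs.
- rewrite -kermx_eq0; apply/eqP/row_matrixP => i; rewrite row0.
  have : row i (kermx S) *m S = 0 by apply/sub_kermxP; exact: row_sub.
  rewrite mul_rV_lin1 /= => /(congr1 frame_emb).
  rewrite frame_coordK linear0 => /eqP.
  by rewrite vecof_eq0// => /eqP.
apply/row_matrixP => i; rewrite !row_mul !rowE !mul_rV_lin1/=.
by rewrite rVofK// frame_coordK.
Qed.

Lemma is_O_frame phi : is_O phi <-> frame_mx phi *m (frame_mx phi)^T = 1%:M.
Proof.
split=> [phiO|PP u v].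
  apply/matrixP => i j.
  have := phiO (frame_emb (delta_mx 0 i)) (frame_emb (delta_mx 0 j)).
  rewrite !dotrv_coord -!mul_frame_mx !frame_embK -!rowE => h.
  have -> : (frame_mx phi *m (frame_mx phi)^T) i j =
      dotrv (row i (frame_mx phi)) (row j (frame_mx phi)).
    by rewrite !mxE; apply: eq_bigr => l _; rewrite !mxE.
  rewrite h dotrvE mxE (bigD1 i)//= big1 ?addr0 => [|l li].
    by rewrite !mxE !eqxx mul1r eq_sym.
  by rewrite !mxE (negbTE li) andbF mul0r.
by rewrite !vsval_frame_mx (dotrv_mul _ _ AA) (dotrv_mul _ _ PP) -dotrv_coord.
Qed.

Definition congr_by (K L : set 'rV[R]_n) (P : 'M[R]_k) (a : 'rV[R]_k) :=
  forall c, K (c *m A) <-> L ((c *m P - a) *m A).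

Lemma image_in_frame K L phi (a : 'rV[R]_k) :
  frame_mx phi *m (frame_mx phi)^T = 1%:M ->
  image_in phi (section_by K rowvs) = translate (section_by L rowvs) (a *m A) <->
  congr_by K L (frame_mx phi) a.
Proof.
move=> PP; have PV : (frame_mx phi)^T *m frame_mx phi = 1%:M by exact: mulmx1C.
split=> [E c|E].
  split=> [Kc|Lc].
    have : image_in phi (section_by K rowvs) (c *m frame_mx phi *m A).
      exists (frame_emb c).
        by rewrite /= vsval_emb; split => //; exact: mulmx_rowvs.
      by rewrite vsval_frame_mx frame_embK.
    rewrite E => -[y [Ly _] yE]; rewrite mulmxBl -yE.
    by rewrite addrK.
  have : translate (section_by L rowvs) (a *m A) (c *m frame_mx phi *m A).
    exists ((c *m frame_mx phi - a) *m A); last by rewrite mulmxBl subrK.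
    by split => //; exact: mulmx_rowvs.
  rewrite -E => -[u [Ku _]]; rewrite vsval_frame_mx.
  move=> /(congr1 (mulmxr (A^T *m (frame_mx phi)^T))).
  rewrite /= !mulmxA !mul_frameK -!mulmxA PP !mulmx1 => uc.
  by rewrite -uc rowvsK ?subvsP.
apply/seteqP; split=> [_ [u [Ku _] <-]|_ [x [Lx xr] <-]].
  exists ((frame_coord u *m frame_mx phi - a) *m A).
    split; last exact: mulmx_rowvs.
    by apply/E; rewrite rowvsK ?subvsP.
  by rewrite mulmxBl subrK vsval_frame_mx.
pose c := (x *m A^T + a) *m (frame_mx phi)^T.
have cP : c *m frame_mx phi = x *m A^T + a by rewrite -mulmxA PV mulmx1.
exists (frame_emb c); last first.
  by rewrite vsval_frame_mx frame_embK cP mulmxDl rowvsK.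
split; last exact: subvsP.
by rewrite vsval_emb; apply/E; rewrite cP addrK rowvsK.
Qed.

Lemma directly_congruent_frame K L :
  directly_congruent rowvs (section_by K rowvs) (section_by L rowvs) ->
  exists (P : 'M[R]_k) a, [/\ P *m P^T = 1%:M, \det P = 1 & congr_by K L P a].
Proof.
move=> [phi [a [[/is_O_frame PP dphi] /mem_rowvs[a' ->] E]]].
exists (frame_mx phi), a'; split => //; first by rewrite -det_end_frame.
exact/image_in_frame.
Qed.

Lemma no_SO_symmetry_frame K : ~ has_SO_symmetry rowvs (section_by K rowvs) ->
  forall P a, P *m P^T = 1%:M -> \det P = 1 -> congr_by K K P a -> P = 1%:M.
Proof.
move=> noS P a PP dP E; apply: contrapT => P1; apply: noS.
exists (frame_end P), (a *m A); split.
- by split; [apply/is_O_frame; rewrite frame_endK|rewrite det_end_frame frame_endK].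
- move=> P1E; apply: P1; rewrite -(frame_endK P) P1E.
  by apply/row_matrixP => i; rewrite !rowE mul_frame_mx lfunE/= frame_embK mulmx1.
- exact: mulmx_rowvs.
- by apply/image_in_frame; rewrite frame_endK.
Qed.

End Frame.

(** * Continuity, closedness and compactness *)

Section RealContinuity.
Variables (R : realType) (T : topologicalType).
Implicit Types f g : T -> R.

Lemma cont_cst (c : R) : continuous (fun _ : T => c).
Proof. by move=> x; exact: cvg_cst. Qed.

Lemma cont_add f g : continuous f -> continuous g ->
  continuous (fun x => f x + g x).
Proof. by move=> cf cg x; apply: cvgD; [exact: cf|exact: cg]. Qed.

Lemma cont_opp f : continuous f -> continuous (fun x => - f x).
Proof. by move=> cf x; apply: cvgN; exact: cf. Qed.

Lemma cont_mul f g : continuous f -> continuous g ->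
  continuous (fun x => f x * g x).
Proof. by move=> cf cg x; apply: cvgM; [exact: cf|exact: cg]. Qed.

Lemma cont_inv f : (forall x, f x != 0) -> continuous f ->
  continuous (fun x => (f x)^-1).
Proof. by move=> f0 cf x; apply: cvgV => //; exact: cf. Qed.

Lemma cont_exp f n : continuous f -> continuous (fun x => f x ^+ n).
Proof.
move=> cf; elim: n => [|n IH]; first exact: cont_cst.
by under eq_fun do rewrite exprS; exact: cont_mul.
Qed.

Lemma cont_comp (U V W : topologicalType) (g : V -> W) (f : U -> V) :
  continuous f -> continuous g -> continuous (fun x => g (f x)).
Proof. by move=> cf cg x; apply: (continuous_comp (cf x)); exact: cg. Qed.

Lemma cont_pair (U V : topologicalType) (f : T -> U) (g : T -> V) :
  continuous f -> continuous g -> continuous (fun x => (f x, g x)).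
Proof. by move=> cf cg x; apply: cvg_pair; [exact: cf|exact: cg]. Qed.

Lemma cont_fst (U V : topologicalType) : continuous (@fst U V).
Proof. by move=> x; exact: cvg_fst. Qed.

Lemma cont_snd (U V : topologicalType) : continuous (@snd U V).
Proof. by move=> x; exact: cvg_snd. Qed.

Lemma cont_id : continuous (fun x : T => x).
Proof. by move=> x; exact: cvg_id. Qed.

End RealContinuity.

Ltac cont := repeat first
  [ assumption
  | match goal with
    | |- continuous (fun _ => ?c) => exact: cont_cst
    | |- continuous (fun x => @?f x + @?g x) => apply: (@cont_add _ _ f g)
    | |- continuous (fun x => - @?f x) => apply: (@cont_opp _ _ f)
    | |- continuous (fun x => @?f x * @?g x) => apply: (@cont_mul _ _ f g)
    | |- continuous (fun x => @?f x ^+ ?n) => apply: (@cont_exp _ _ f n)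
    | |- continuous (fun x => x.1) => exact: cont_fst
    | |- continuous (fun x => x.2) => exact: cont_snd
    | |- continuous fst => exact: cont_fst
    | |- continuous snd => exact: cont_snd
    | |- continuous (fun x => x) => exact: cont_id
    end ].

Section MatrixContinuity.
Variables (R : realType) (T : topologicalType).

Lemma cont_sum (I : finType) (f : I -> T -> R) :
  (forall i, continuous (f i)) -> continuous (fun x => \sum_i f i x).
Proof. by move=> cf; apply: continuous_big => //; exact: add_continuous. Qed.

Lemma cvg_mx m n (F : set_system T) (FF : Filter F) (f : T -> 'M[R]_(m, n))
    (M : 'M[R]_(m, n)) :
  (forall i j, f x i j @[x --> F] --> M i j) -> f x @[x --> F] --> M.
Proof.
move=> fM A [P PM PA]; rewrite nbhs_simpl /=.
have : \forall x \near F, forall i j, P i j (f x i j).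
  by apply: filter_forall => i; apply: filter_forall => j; exact: fM (PM i j).
by apply: filterS => x; exact: PA.
Qed.

(** Continuity of each entry, which is what the algebraic operations preserve;
    it is equivalent to continuity for the product topology on matrices. *)
Definition econt m n (f : T -> 'M[R]_(m, n)) :=
  forall i j, continuous (fun x => f x i j).

Lemma econt_continuous m n (f : T -> 'M[R]_(m, n)) : econt f -> continuous f.
Proof. by move=> ef x; apply: cvg_mx => i j; exact: ef. Qed.

Lemma continuous_econt m n (f : T -> 'M[R]_(m, n)) : continuous f -> econt f.
Proof.
move=> cf i j; apply: (cont_comp (g := fun M : 'M[R]_(m, n) => M i j) cf).
exact: coord_continuous.
Qed.

Lemma econt_cst m n (M : 'M[R]_(m, n)) : econt (fun _ => M).
Proof. by move=> i j; exact: cont_cst. Qed.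

Lemma econt_add m n (f g : T -> 'M[R]_(m, n)) : econt f -> econt g ->
  econt (fun x => f x + g x).
Proof. by move=> ef eg i j; under eq_fun do rewrite mxE; exact: cont_add. Qed.

Lemma econt_opp m n (f : T -> 'M[R]_(m, n)) : econt f -> econt (fun x => - f x).
Proof. by move=> ef i j; under eq_fun do rewrite mxE; exact: cont_opp. Qed.

Lemma econt_scale m n (a : T -> R) (f : T -> 'M[R]_(m, n)) : continuous a ->
  econt f -> econt (fun x => a x *: f x).
Proof. by move=> ca ef i j; under eq_fun do rewrite mxE; exact: cont_mul. Qed.

Lemma econt_tr m n (f : T -> 'M[R]_(m, n)) : econt f -> econt (fun x => (f x)^T).
Proof. by move=> ef i j; under eq_fun do rewrite mxE; exact: ef. Qed.

Lemma econt_mul m n p (f : T -> 'M[R]_(m, n)) (g : T -> 'M[R]_(n, p)) :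
  econt f -> econt g -> econt (fun x => f x *m g x).
Proof.
move=> ef eg i j; under eq_fun do rewrite mxE.
by apply: cont_sum => k; exact: cont_mul.
Qed.

Lemma cont_dotrv n (f g : T -> 'rV[R]_n) : econt f -> econt g ->
  continuous (fun x => dotrv (f x) (g x)).
Proof. by move=> ef eg; apply: cont_sum => i; exact: cont_mul. Qed.

End MatrixContinuity.

Ltac econt := repeat first
  [ assumption
  | match goal with
    | |- econt (fun _ => ?M) => exact: econt_cst
    | |- econt (fun x => @?f x + @?g x) => apply: (@econt_add _ _ _ _ f g)
    | |- econt (fun x => - @?f x) => apply: (@econt_opp _ _ _ _ f)
    | |- econt (fun x => @?a x *: @?f x) => apply: (@econt_scale _ _ _ _ a f)
    | |- econt (fun x => (@?f x)^T) => apply: (@econt_tr _ _ _ _ f)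
    | |- econt (fun x => @?f x *m @?g x) => apply: (@econt_mul _ _ _ _ _ f g)
    | |- continuous (fun _ => ?c) => exact: cont_cst
    | |- continuous (fun x => dotrv (@?f x) (@?g x)) =>
        apply: (@cont_dotrv _ _ _ f g)
    | |- continuous (fun x => @?f x + @?g x) => apply: (@cont_add _ _ f g)
    | |- continuous (fun x => - @?f x) => apply: (@cont_opp _ _ f)
    | |- continuous (fun x => @?f x * @?g x) => apply: (@cont_mul _ _ f g)
    | |- continuous (fun x => x) => exact: cont_id
    | |- continuous id => exact: cont_id
    end ].

Section ClosedSets.
Variables (R : realType) (T : topologicalType).

Lemma closed_forall (I : Type) (P : I -> T -> Prop) :
  (forall i, closed [set x | P i x]) -> closed [set x | forall i, P i x].
Proof.
move=> cP; have -> : [set x | forall i, P i x] = \bigcap_(i in setT) [set x | P i x].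
  by apply/seteqP; split=> x /= h i; [move=> _|]; exact: h.
by apply: closed_bigI => i _; exact: cP.
Qed.

Lemma closed_preimage (U : topologicalType) (f : T -> U) (A : set U) :
  continuous f -> closed A -> closed [set x | A (f x)].
Proof. by move=> cf; apply: preimage_closed => x _; exact: cf. Qed.

Lemma closed_eqfun (f g : T -> R) : continuous f -> continuous g ->
  closed [set x | f x = g x].
Proof.
move=> cf cg; have -> : [set x | f x = g x] = [set x | f x - g x = 0].
  apply/seteqP; split=> x /= h; first by rewrite h subrr.
  by apply/eqP; rewrite -subr_eq0 h.
apply: (closed_preimage (f := fun x => f x - g x) (A := [set r | r = 0])).
  by cont.
exact: closed_eq.
Qed.

Lemma closed_eqmx m n (f g : T -> 'M[R]_(m, n)) : econt f -> econt g ->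
  closed [set x | f x = g x].
Proof.
move=> ef eg; have -> : [set x | f x = g x] = [set x | forall i j, f x i j = g x i j].
  by apply/seteqP; split=> x /=; [move=> ->|move/matrixP].
by apply: closed_forall => i; apply: closed_forall => j; exact: closed_eqfun.
Qed.

Lemma closed_imply (U V : topologicalType) (f : T -> U) (g : T -> V)
    (A : set U) (C : set V) : continuous f -> continuous g -> open A -> closed C ->
  closed [set x | A (f x) -> C (g x)].
Proof.
move=> cf cg oA cC.
have -> : [set x | A (f x) -> C (g x)] =
    [set x | (~` A) (f x)] `|` [set x | C (g x)].
  apply/seteqP; split=> x /=; last by move=> [nA /nA|].
  by have [Af|nA] := pselect (A (f x)); [move=> /(_ Af); right|left].
apply: closedU; first exact: (closed_preimage cf (open_closedC oA)).
exact: (closed_preimage cg cC).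
Qed.

End ClosedSets.

(** Each point of [V] outside a neighbourhood [Q] of [f t0] has a neighbourhood
    that the graph avoids near [t0]; by compactness finitely many of them cover
    the rest of [V], so near [t0] the value [f t] lies in [Q]. *)
Lemma closed_graph_continuous (T Y : topologicalType) (f : T -> Y) (V : set Y) :
  hausdorff_space Y -> compact V -> (forall t, V (f t)) ->
  closed [set p : T * Y | p.2 = f p.1] -> continuous f.
Proof.
move=> hY cV fV cG t0 U; rewrite nbhsE => -[Q [oQ Qt0] QU].
have cVO : compact (V `\` Q).
  apply: (subclosed_compact _ cV); last by move=> y [].
  by apply: closedI; [exact: compact_closed|exact: open_closedC].
have /compact_near_coveringP cov := cVO.
have : \forall t \near t0, V `\` Q `<=` (fun y => y <> f t).
  apply: (cov T (nbhs t0) (fun t y => y <> f t)) => y [Vy nOy].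
  have : nbhs (t0, y) (~` [set p : T * Y | p.2 = f p.1]).
    apply: open_nbhs_nbhs; split; first exact: closed_openC.
    by move=> /= yf; apply: nOy; rewrite yf.
  move=> [[A1 A2] /= [tA1 yA2] AG]; exists (A2, A1) => // -[y' t] [/= ? ?].
  exact: (AG (t, y')).
apply: filterS => t h; apply: QU; apply: contrapT => nQ.
by apply: (h (f t)).
Qed.

(** The box is the image of a product of intervals under [vec_mx]. *)
Lemma compact_mx_box (R : realType) m n :
  compact [set M : 'M[R]_(m, n) | forall i j, -1 <= M i j <= 1].
Proof.
pose box : set 'rV[R]_(m * n) := [set v | forall i, `[-1, 1]%classic (v 0 i)].
have cbox : compact box.
  apply: (@rV_compact _ _ (fun=> `[-1 : R, 1]%classic)) => i.
  exact: segment_compact.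
have -> : [set M : 'M[R]_(m, n) | forall i j, -1 <= M i j <= 1] = vec_mx @` box.
  apply/seteqP; split=> [M MB|_ [v vB <-] i j].
    exists (mxvec M); last exact: mxvecK.
    move=> k; case/mxvec_indexP: k => i j.
    by rewrite /= mxvecE in_itv/=; exact: MB.
  by have := vB (mxvec_index i j); rewrite !mxE /= in_itv.
apply: continuous_compact => //; apply: continuous_subspaceT.
apply: econt_continuous => i j; under eq_fun do rewrite mxE.
exact: coord_continuous.
Qed.

(** * Winding of a planar field on the disc *)

Section Winding.
Variable R : realType.
Implicit Types (x y t s a : R).

Definition has_angle x y a :=
  exists2 r, 0 < r & x = r * cos a /\ y = r * sin a.

(** The turn from [(x, y)] to [(x', y')] is less than a right angle, so it is
    the arctangent of cross product over inner product. *)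
Lemma has_angle_turn x y a x' y' : has_angle x y a -> 0 < x * x' + y * y' ->
  has_angle x' y' (a + atan ((x * y' - y * x') / (x * x' + y * y'))).
Proof.
move=> [r r0 [xE yE]]; set c := x * x' + _; set d := x * y' - _ => c0.
set u := d / c; have k0 : 0 < cos (atan u).
  by apply: cos_gt0_pihalf; rewrite atan_gtNpi2 atan_ltpi2.
have su : sin (atan u) = u * cos (atan u).
  by rewrite -{2}(atanK u) /tan mulfVK// gt_eqF.
have cs := cos2Dsin2 a.
have uc : u * c = d by rewrite /u mulfVK// gt_eqF.
have r0' : r != 0 by rewrite gt_eqF.
have k0' : cos (atan u) != 0 by rewrite gt_eqF.
exists (c / (r * cos (atan u))).
  by rewrite divr_gt0 ?mulr_gt0.
rewrite cosD sinD su; split.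
  transitivity ((c * cos a - (u * c) * sin a) / r); last by field; rewrite r0' k0'.
  rewrite uc /c /d xE yE.
  transitivity (x' * (cos a ^+ 2 + sin a ^+ 2)); first by rewrite cs mulr1.
  by field.
transitivity ((c * sin a + (u * c) * cos a) / r); last by field; rewrite r0' k0'.
rewrite uc /c /d xE yE.
transitivity (y' * (cos a ^+ 2 + sin a ^+ 2)); first by rewrite cs mulr1.
by field.
Qed.

Lemma has_angle_exists x y : 0 < x ^+ 2 + y ^+ 2 -> exists a, has_angle x y a.
Proof.
move=> xy.
have go a : 0 < cos a * x + sin a * y -> exists a, has_angle x y a.
  move=> h; eexists; apply: (@has_angle_turn (cos a) (sin a) a) h.
  by exists 1; rewrite ?mul1r.
have [x0|x0|x0] := ltgtP x 0.
- by apply: (go pi); rewrite cospi sinpi; lra.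
- by apply: (go 0); rewrite cos0 sin0; lra.
have [y0|y0|y0] := ltgtP y 0.
- by apply: (go (- (pi / 2))); rewrite cosN sinN cos_pihalf sin_pihalf; lra.
- by apply: (go (pi / 2)); rewrite cos_pihalf sin_pihalf; lra.
by move: xy; rewrite x0 y0 expr0n/= addr0 ltxx.
Qed.

(** Connectedness of the unit interval. *)
Lemma locally_constant_itv (P : R -> Prop) :
  (forall s, \forall s' \near s, P s <-> P s') -> P 0 -> P 1.
Proof.
move=> locP P0.
have /(_ (`[0, 1] `&` P)) E := @segment_connected R 0 1.
have : (`[0, 1] `&` P) 1.
  rewrite E; first by rewrite /= in_itv/= ler01 lexx.
  - by exists 0; split => //=; rewrite in_itv/= ler01 lexx.
  - exists P => //; rewrite openE => s Ps; apply: filterS (locP s).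
    by move=> s' [+ _]; exact.
  exists P => //; rewrite -[P]setCK; apply: open_closedC.
  rewrite openE => s nPs; apply: filterS (locP s).
  by move=> s' [_ h] /h.
by case.
Qed.

Lemma sqr_le1 x : x ^+ 2 <= 1 -> -1 <= x <= 1.
Proof.
by move=> x1; rewrite -ler_norml -(@expr_le1 _ 2)// real_normK// num_real.
Qed.

Definition unit_circle : set (R * R) := [set p | p.1 ^+ 2 + p.2 ^+ 2 = 1].

Lemma compact_circle : compact unit_circle.
Proof.
have cB : compact (`[-1 : R, 1] `*` `[-1 : R, 1]).
  by apply: compact_setX; exact: segment_compact.
apply: (subclosed_compact _ cB).
- rewrite (_ : unit_circle = (fun p : R * R => p.1 ^+ 2 + p.2 ^+ 2) @^-1` [set 1])//.
  apply: preimage_closed; last exact: closed_eq.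
  by move=> p _; move: p; cont.
move=> [a b] /= ab; rewrite !in_itv/=.
by split; apply: sqr_le1; rewrite -ab ?lerDl ?lerDr sqr_ge0.
Qed.

(** The circles of radius [s] deform the boundary circle to the centre, where the
    field is constant and the angle obviously exists.  When [s'] is close to [s]
    the fields on the two circles make acute angles, uniformly by compactness of
    the circle, and the angle is carried over by [has_angle_turn]. *)
Lemma circle_lift (g1 g2 : R * R -> R) :
  continuous g1 -> continuous g2 -> (forall p, 0 < g1 p ^+ 2 + g2 p ^+ 2) ->
  exists al : R -> R, [/\ continuous al, forall t, al (t + pi *+ 2) = al t
    & forall t, has_angle (g1 (cos t, sin t)) (g2 (cos t, sin t)) (al t)].
Proof.
move=> c1 c2 g0.
pose sc (s : R) (p : R * R) := (s * p.1, s * p.2).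
pose e (t : R) := (cos t, sin t).
pose P s := exists al : R -> R, [/\ continuous al, forall t, al (t + pi *+ 2) = al t
  & forall t, has_angle (g1 (sc s (e t))) (g2 (sc s (e t))) (al t)].
suff [al [? ? h]] : P 1.
  by exists al; split => // t; have := h t; rewrite /sc !mul1r.
have csc s : continuous (sc s) by apply: cont_pair; cont.
have ce : continuous e.
  by apply: cont_pair; [exact: continuous_cos|exact: continuous_sin].
pose D s s' p := g1 (sc s p) * g1 (sc s' p) + g2 (sc s p) * g2 (sc s' p).
have DP s s' : (forall t, 0 < D s s' (e t)) -> P s -> P s'.
  move=> D0 [al [cal pal hal]].
  exists (fun t => al t + atan ((g1 (sc s (e t)) * g2 (sc s' (e t))
     - g2 (sc s (e t)) * g1 (sc s' (e t))) / D s s' (e t))); split.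
  - have cg (g : R * R -> R) r : continuous g -> continuous (fun t => g (sc r (e t))).
      move=> cg; apply: (cont_comp (f := fun t => sc r (e t))) => //.
      exact: (cont_comp ce (csc r)).
    apply: cont_add => //; apply: cont_comp; last exact: continuous_atan.
    apply: cont_mul; last apply: cont_inv.
    + by apply: cont_add; last apply: cont_opp; apply: cont_mul; exact: cg.
    + by move=> t; rewrite gt_eqF.
    + by apply: cont_add; apply: cont_mul; exact: cg.
  - by move=> t; rewrite pal /e cosD2pi sinD2pi.
  - by move=> t; exact: has_angle_turn (hal t) (D0 t).
apply: locally_constant_itv; last first.
  have [al h] := has_angle_exists (g0 (0, 0)).
  exists (fun=> al); split => //; first exact: cont_cst.
  by move=> t; rewrite /sc !mul0r.
move=> s.
have : \forall s' \near s, unit_circle `<=` (fun p => 0 < D s s' p).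
  have /compact_near_coveringP cov := compact_circle.
  apply: (cov R (nbhs s) (fun s' p => 0 < D s s' p)) => p _.
  have cD : continuous (fun q : (R * R) * R => D s q.2 q.1).
    have cg (g : R * R -> R) (r : (R * R) * R -> R) : continuous g ->
        continuous r -> continuous (fun q => g (sc (r q) q.1)).
      move=> cg cr; apply: (cont_comp (f := fun q : (R * R) * R => sc (r q) q.1)) => //.
      apply: cont_pair; apply: cont_mul => //;
      (apply: cont_comp; first exact: cont_fst); [exact: cont_fst|exact: cont_snd].
    by apply: cont_add; apply: cont_mul; apply: cg => //; cont.
  have := cD (p, s); rewrite /continuous_at /= => /(_ [set x | 0 < x]).
  apply; apply: open_nbhs_nbhs; split; first exact: open_gt.
  by rewrite /= /D -!expr2.
apply: filterS => s' h.
have {}h t : 0 < D s s' (e t) by apply: h; rewrite /unit_circle /= cos2Dsin2.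
split; first exact: DP.
by apply: DP => t; have := h t; rewrite /D mulrC [X in _ + X]mulrC.
Qed.

End Winding.

(** * Quadratic forms on the tangent planes of the two-sphere *)

Section Umbilic.
Variable R : realType.
Implicit Types (t : R).

(** A continuous function with values in the multiples of [2 pi]. *)
Lemma cos_eq1_const (f : R -> R) : continuous f -> (forall t, cos (f t) = 1) ->
  forall t, f t = f 0.
Proof.
move=> cf f1 t0.
have close (x y : R) : cos x = 1 -> cos y = 1 -> `|x - y| < 1 -> x = y.
  move=> x1 y1 xy; apply/eqP; rewrite -subr_eq0 -normr_eq0; apply/eqP.
  apply: cos_inj; last first.
    have sx : sin x = 0 by apply: cos1sin0; rewrite x1 normr1.
    by rewrite cos_norm cosB x1 y1 cos0 sx mulr1 mul0r addr0.
  - by rewrite in_itv/= lexx pi_ge0.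
  - rewrite in_itv/= normr_ge0/=; apply: le_trans (ltW xy) _.
    by apply: le_trans (pi_ge2 R); lra.
suff : f (1 * t0) = f 0 by rewrite mul1r.
apply: (@locally_constant_itv _ (fun s => f (s * t0) = f 0)); last by rewrite mul0r.
move=> s; have cg : continuous (fun s : R => f (s * t0)).
  by apply: (cont_comp (f := fun s : R => s * t0)) => //; cont.
have := cg s; rewrite /continuous_at => /cvgrPdist_lt /(_ 1 ltr01).
by apply: filterS => s' /close E; rewrite E.
Qed.

Definition bil n (M : 'M[R]_n) (u v : 'rV[R]_n) : R := dotrv (u *m M) v.

Lemma bil_span2 n (M : 'M[R]_n) x y x' y' (u v : 'rV[R]_n) :
  bil M (x *: u + y *: v) (x' *: u + y' *: v) =
  x * x' * bil M u u + x * y' * bil M u v + y * x' * bil M v u + y * y' * bil M v v.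
Proof.
rewrite /bil mulmxDl -!scalemxAl !(dotrvDl, dotrvDr, dotrvZl, dotrvZr).
by ring.
Qed.

Definition row3 (x y z : R) : 'rV[R]_3 := \row_(i < 3) [:: x; y; z]`_i.

(** Inverse stereographic projection from the south pole, so that the closed unit
    disc covers the northern hemisphere and the unit circle is the equator. *)
Definition stereo (p : R * R) : 'rV[R]_3 :=
  (1 + (p.1 ^+ 2 + p.2 ^+ 2))^-1 *:
    row3 (2 * p.1) (2 * p.2) (1 - (p.1 ^+ 2 + p.2 ^+ 2)).

(** With [frame2], the coordinate directions of the chart normalised: an
    orthonormal frame of the tangent plane at [stereo p], defined on the whole
    plane. *)
Definition frame1 (p : R * R) : 'rV[R]_3 :=
  row3 1 0 0 - (2 * p.1 / (1 + (p.1 ^+ 2 + p.2 ^+ 2))) *: row3 p.1 p.2 1.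

Definition frame2 (p : R * R) : 'rV[R]_3 :=
  row3 0 1 0 - (2 * p.2 / (1 + (p.1 ^+ 2 + p.2 ^+ 2))) *: row3 p.1 p.2 1.

Lemma stereo_den (p : R * R) : 1 + (p.1 ^+ 2 + p.2 ^+ 2) != 0.
Proof. by rewrite gt_eqF// ltr_wpDr// addr_ge0 ?sqr_ge0. Qed.

Lemma econt_row3 (T : topologicalType) (f g h : T -> R) : continuous f ->
  continuous g -> continuous h -> econt (fun p => row3 (f p) (g p) (h p)).
Proof.
by move=> cf cg ch i [[|[|[|//]]] Hj]; under eq_fun do rewrite mxE /=.
Qed.

Let cont_den : continuous (fun p : R * R => (1 + (p.1 ^+ 2 + p.2 ^+ 2))^-1).
Proof.
apply: (@cont_inv R _ (fun p : R * R => 1 + (p.1 ^+ 2 + p.2 ^+ 2))).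
  exact: stereo_den.
by cont.
Qed.

Lemma econt_stereo : econt stereo.
Proof. by rewrite /stereo; econt; apply: econt_row3; cont. Qed.

Lemma econt_frame1 : econt frame1.
Proof. by rewrite /frame1; econt; cont; apply: econt_row3; cont. Qed.

Lemma econt_frame2 : econt frame2.
Proof. by rewrite /frame2; econt; cont; apply: econt_row3; cont. Qed.

Lemma dotrv3 (u v : 'rV[R]_3) :
  dotrv u v = u 0 0 * v 0 0 + u 0 1 * v 0 1 + u 0 2%:R * v 0 2%:R.
Proof.
rewrite /dotrv !big_ord_recl big_ord0 addr0 addrA.
by congr (_ * _ + _ * _ + _ * _); congr (_ _ _); exact: val_inj.
Qed.

Lemma stereo_frame p :
  [/\ dotrv (stereo p) (stereo p) = 1, dotrv (frame1 p) (frame1 p) = 1,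
      dotrv (frame2 p) (frame2 p) = 1 &
   [/\ dotrv (stereo p) (frame1 p) = 0, dotrv (stereo p) (frame2 p) = 0
    & dotrv (frame1 p) (frame2 p) = 0]].
Proof.
have d := stereo_den p; case: p d => a b /= d.
by split; [| | | split]; rewrite !dotrv3 !mxE/=; field.
Qed.

(** Real and imaginary part of [bil M] at the complex vector
    [frame1 p + i frame2 p].  They vanish together exactly when the symmetric part
    of [M] is a multiple of the inner product on the tangent plane. *)
Definition umbilic_re (M : 'M[R]_3) p :=
  bil M (frame1 p) (frame1 p) - bil M (frame2 p) (frame2 p).
Definition umbilic_im (M : 'M[R]_3) p :=
  bil M (frame1 p) (frame2 p) + bil M (frame2 p) (frame1 p).

(** At the equator point of angle [t] the complex vector [frame1 + i frame2] is,
    up to a unit constant, [exp (i t)] times [tangent + i vertical]; hence the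
    complex number [umbilic_re + i umbilic_im] is [exp (2 i t) (q - i s)].
    Passing to the antipode reverses the vertical direction against the
    tangential one, which changes the sign of [s]. *)
Lemma umbilic_antipodal (M : 'M[R]_3) t : exists q s,
  [/\ umbilic_re M (cos t, sin t) = cos (2 * t) * q + sin (2 * t) * s,
      umbilic_im M (cos t, sin t) = sin (2 * t) * q - cos (2 * t) * s,
      umbilic_re M (- cos t, - sin t) = cos (2 * t) * q - sin (2 * t) * s &
      umbilic_im M (- cos t, - sin t) = sin (2 * t) * q + cos (2 * t) * s].
Proof.
have ab := cos2Dsin2 t.
have -> : cos (2 * t) = cos t ^+ 2 - sin t ^+ 2 by rewrite mulrDl mul1r cosD -!expr2.
have -> : sin (2 * t) = 2 * cos t * sin t by rewrite mulrDl mul1r sinD; ring.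
move: (cos t) (sin t) ab => a b ab.
pose ta := row3 (- b) a 0; pose ve := row3 0 0 1.
have fr e : e ^+ 2 = 1 -> frame1 (e * a, e * b) = (- b) *: ta + (- (e * a)) *: ve /\
    frame2 (e * a, e * b) = a *: ta + (- (e * b)) *: ve.
  move=> e2; rewrite /frame1 /frame2 /= !exprMn e2 !mul1r ab.
  have half x : 2 * (e * x) / (1 + 1) = e * x by field.
  have e2' x y : e * x * (e * y) = x * y by rewrite mulrACA -expr2 e2 mul1r.
  split; apply/rowP => i; rewrite !mxE; case: i => -[|[|[|//]]] ? /=;
    rewrite ?half ?e2'; nra.
have [f1 f2] := fr 1 (expr1n _ _); rewrite !mul1r in f1 f2.
have [f1' f2'] := fr (-1) ltac:(by rewrite sqrrN expr1n).
rewrite !mulN1r !opprK in f1' f2'.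
exists (bil M ve ve - bil M ta ta), (bil M ta ve + bil M ve ta).
rewrite /umbilic_re /umbilic_im f1 f2 f1' f2' !bil_span2.
by split; ring.
Qed.

(** Otherwise let [al] be a continuous angle of the field on the circle.  By
    [umbilic_antipodal] the angles at [t] and [t + pi] are [2 t - b] and
    [2 t + b] up to multiples of [2 pi], so [al t + al (t + pi) - 4 t] is
    constant.  Comparing [t = 0] with [t = pi] and using the periodicity of [al]
    gives [4 pi = 0]. *)
Lemma umbilic_exists (M : R * R -> 'M[R]_3) :
  (forall i j, continuous (fun p => M p i j)) ->
  (forall p, unit_circle p -> M (- p.1, - p.2) = M p) ->
  exists p, umbilic_re (M p) p = 0 /\ umbilic_im (M p) p = 0.
Proof.
move=> cM evM; apply: contrapT => noumb.
have cE (u v : R * R -> 'rV[R]_3) : econt u -> econt v ->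
    continuous (fun p => bil (M p) (u p) (v p)).
  by move=> eu ev; rewrite /bil; econt; exact: cM.
have c1 := econt_frame1; have c2 := econt_frame2.
have [p|al [cal pal hal]] :=
  @circle_lift _ (fun p => umbilic_re (M p) p) (fun p => umbilic_im (M p) p)
    ltac:(rewrite /umbilic_re; cont; exact: cE)
    ltac:(rewrite /umbilic_im; cont; exact: cE).
  rewrite lt_neqAle addr_ge0 ?sqr_ge0// andbT eq_sym paddr_eq0 ?sqr_ge0//.
  rewrite !sqrf_eq0; apply/negP => /andP[/eqP ? /eqP ?].
  by apply: noumb; exists p.
have f1 t : cos (al t + al (t + pi) - 4 * t) = 1.
  have [q [s [h1 h2 h1' h2']]] := umbilic_antipodal (M (cos t, sin t)) t.
  have [r r0 [rc rs]] := hal t.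
  have [r' r0' [rc' rs']] := hal (t + pi).
  have evt : M (- cos t, - sin t) = M (cos t, sin t).
    by apply: (evM (cos t, sin t)); exact: cos2Dsin2.
  move: rc rs rc' rs'; rewrite cosDpi sinDpi evt.
  rewrite h1 h2 h1' h2'.
  set be := al t - 2 * t; set be' := al (t + pi) - 2 * t.
  have -> : al t + al (t + pi) - 4 * t = be + be' by rewrite /be /be'; ring.
  have -> : al t = be + 2 * t by rewrite subrK.
  have -> : al (t + pi) = be' + 2 * t by rewrite subrK.
  clearbody be be'; rewrite !cosD !sinD.
  move: (cos2Dsin2 (2 * t)) (cos2Dsin2 be) (cos2Dsin2 be').
  move: (cos (2 * t)) (sin (2 * t)) (cos be) (sin be) (cos be') (sin be').
  move=> C S c d c' d' CS cd cd' E1 E2 E3 E4.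
  have q1 : q = r * c.
    have : C * (C * q + S * s) + S * (S * q - C * s) = (C ^+ 2 + S ^+ 2) * q by ring.
    rewrite E1 E2 CS mul1r => <-.
    by transitivity ((C ^+ 2 + S ^+ 2) * (r * c)); [ring|rewrite CS mul1r].
  have s1 : - s = r * d.
    have : C * (S * q - C * s) - S * (C * q + S * s) = (C ^+ 2 + S ^+ 2) * (- s) by ring.
    rewrite E1 E2 CS mul1r => <-.
    by transitivity ((C ^+ 2 + S ^+ 2) * (r * d)); [ring|rewrite CS mul1r].
  have q2 : q = r' * c'.
    have : C * (C * q - S * s) + S * (S * q + C * s) = (C ^+ 2 + S ^+ 2) * q by ring.
    rewrite E3 E4 CS mul1r => <-.
    by transitivity ((C ^+ 2 + S ^+ 2) * (r' * c')); [ring|rewrite CS mul1r].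
  have s2 : s = r' * d'.
    have : C * (S * q + C * s) - S * (C * q - S * s) = (C ^+ 2 + S ^+ 2) * s by ring.
    rewrite E3 E4 CS mul1r => <-.
    by transitivity ((C ^+ 2 + S ^+ 2) * (r' * d')); [ring|rewrite CS mul1r].
  have rq : r ^+ 2 = q ^+ 2 + s ^+ 2.
    by rewrite -sqrrN -[s ^+ 2]sqrrN s1 q1 sqrrN !exprMn -mulrDr cd mulr1.
  have rq' : r' ^+ 2 = q ^+ 2 + s ^+ 2.
    by rewrite s2 q2 !exprMn -mulrDr cd' mulr1.
  have rr : r' = r.
    by apply/eqP; rewrite -(@eqrXn2 _ 2) ?(ltW r0) ?(ltW r0')// rq rq'.
  apply: (mulfI (_ : r ^+ 2 != 0)); first by rewrite expf_neq0// gt_eqF.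
  rewrite mulr1 {2}rq.
  transitivity ((r * c) * (r * c') - (r * d) * (r * d')); first by ring.
  by rewrite -q1 -s1 -rr -q2 -s2; ring.
have cf : continuous (fun t => al t + al (t + pi) - 4 * t).
  by cont; apply: (cont_comp (f := fun t : R => t + pi)) => //; cont.
have /= := cos_eq1_const cf f1 pi.
rewrite -addrA add0r -mulr2n.
have := pal 0; rewrite add0r => ->.
by have := @pi_gt0 R; lra.
Qed.

End Umbilic.

(** * Rotations with an invariant vector *)

Section FixedVector.
Variables (R : realType) (m : nat).
Variables (w : 'rV[R]_(1 + m)) (C : 'M[R]_(m, 1 + m)).
Hypotheses (ww : w *m w^T = 1%:M) (CC : C *m C^T = 1%:M) (wC : w *m C^T = 0).

Let Cw : C *m w^T = 0.
Proof. by apply: trmx_inj; rewrite trmx_mul trmxK wC trmx0. Qed.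

Let Q : 'M[R]_(1 + m) := col_mx w C.

Let QQ : Q *m Q^T = 1%:M.
Proof. by rewrite tr_col_mx mul_col_row ww CC wC Cw -scalar_mx_block. Qed.

Lemma complement_resolution : w^T *m w + C^T *m C = 1%:M.
Proof. by rewrite -mul_row_col -tr_col_mx; exact: mulmx1C QQ. Qed.

Lemma complementK (c : 'rV[R]_(1 + m)) : dotrv c w = 0 -> c *m C^T *m C = c.
Proof.
move=> cw; rewrite -[RHS]mulmx1 -complement_resolution mulmxDr !mulmxA.
by rewrite mulmx_tr_dotrv cw -scalemx1 scale0r mul0mx add0r.
Qed.

Lemma complement_ortho (c : 'rV[R]_m) : dotrv (c *m C) w = 0.
Proof. by rewrite dotrvE -mulmxA Cw mulmx0 mxE. Qed.

(** The endomorphism that fixes [w] and acts as [P] on its complement, where the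
    rows of [C] are an orthonormal basis of that complement. *)
Definition fix_ext (P : 'M[R]_m) : 'M[R]_(1 + m) := w^T *m w + C^T *m P *m C.

Lemma fix_ext_w P : w *m fix_ext P = w.
Proof. by rewrite mulmxDr !mulmxA ww wC !mul0mx addr0 mul1mx. Qed.

Lemma fix_ext_compl P (c : 'rV[R]_m) : c *m C *m fix_ext P = c *m P *m C.
Proof.
by rewrite mulmxDr !mulmxA -(mulmxA c) Cw mulmx0 mul0mx add0r -(mulmxA c C) CC mulmx1.
Qed.

Lemma fix_extE P : fix_ext P = Q^T *m block_mx 1%:M 0 0 P *m Q.
Proof.
rewrite tr_col_mx mul_row_block mul_row_col.
by rewrite mulmx1 !mulmx0 addr0 add0r.
Qed.

Lemma fix_ext_orth P : P *m P^T = 1%:M -> fix_ext P *m (fix_ext P)^T = 1%:M.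
Proof.
move=> PP; rewrite fix_extE !trmx_mul trmxK tr_block_mx !mulmxA.
rewrite -(mulmxA _ Q) QQ mulmx1 -(mulmxA Q^T) mulmx_block PP.
rewrite !trmx0 !mulmx0 !mul0mx trmx1 mulmx1 !addr0 add0r -scalar_mx_block mulmx1.
exact: mulmx1C QQ.
Qed.

Lemma fix_ext_det P : \det (fix_ext P) = \det P.
Proof.
rewrite fix_extE !det_mulmx det_ublock det1 mul1r mulrAC -det_mulmx.
by rewrite (mulmx1C QQ) det1 mul1r.
Qed.

Lemma fix_extK (T : 'M[R]_(1 + m)) : T *m T^T = 1%:M -> w *m T = w ->
  fix_ext (C *m T *m C^T) = T.
Proof.
move=> TT wT; have TV := mulmx1C TT.
have wTt : w *m T^T = w by rewrite -{1}wT -mulmxA TT mulmx1.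
have Tw : T *m w^T = w^T by apply: trmx_inj; rewrite trmx_mul trmxK.
rewrite -[RHS]mulmx1 -[RHS]mul1mx -complement_resolution.
rewrite !mulmxDl !mulmxDr !mulmxA -!(mulmxA _ w T) wT.
rewrite -(mulmxA w^T w w^T) ww mulmx1 -(mulmxA w^T w C^T) wC mulmx0 mul0mx addr0.
rewrite -(mulmxA (C^T *m C) T w^T) Tw -(mulmxA C^T C w^T) Cw mulmx0 mul0mx add0r.
by rewrite /fix_ext !mulmxA.
Qed.

End FixedVector.

Lemma det_block11 (R : comNzRingType) (a b c d : R) :
  \det (block_mx a%:M b%:M c%:M d%:M : 'M[R]_(1 + 1)) = a * d - b * c.
Proof.
rewrite (expand_det_row _ (lshift 1 0)) big_split_ord/= !big_ord1 /cofactor.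
rewrite !det_mx11 !mxE.
have -> : @lift (1 + 1) (lshift 1 0) ord0 = rshift 1 (0 : 'I_1) by exact: val_inj.
have -> : @lift (1 + 1) (rshift 1 0) ord0 = lshift 1 (0 : 'I_1) by exact: val_inj.
rewrite !(unsplitK (inl _), unsplitK (inr _)) !(row_mxEl, row_mxEr) !mxE /=.
by rewrite !mulr1n expr0 expr1 mul1r mulN1r mulrN.
Qed.

Section Basis5.
Variables (R : realType) (e w u v x : 'rV[R]_5).
Hypotheses (ee : dotrv e e = 1) (ww : dotrv w w = 1) (uu : dotrv u u = 1)
  (vv : dotrv v v = 1) (xx : dotrv x x = 1) (ew : dotrv e w = 0)
  (eu : dotrv e u = 0) (ev : dotrv e v = 0) (ex : dotrv e x = 0)
  (wu : dotrv w u = 0) (wv : dotrv w v = 0) (wx : dotrv w x = 0)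
  (uv : dotrv u v = 0) (ux : dotrv u x = 0) (vx : dotrv v x = 0).

Let Q1 : 'M[R]_(1 + 1, 5) := col_mx e w.
Let Q2 : 'M[R]_(1 + 1 + 1, 5) := col_mx (col_mx u v) x.
Let Q : 'M[R]_(1 + 1 + (1 + 1 + 1)) := col_mx Q1 Q2.

Let gram2 (a b c d : 'rV[R]_5) : col_mx a b *m (col_mx c d)^T =
  block_mx (dotrv a c)%:M (dotrv a d)%:M (dotrv b c)%:M (dotrv b d)%:M.
Proof. by rewrite tr_col_mx mul_col_row !mulmx_tr_dotrv. Qed.

Let gram3 (a b c a' b' c' : 'rV[R]_5) :
  col_mx (col_mx a b) c *m (col_mx (col_mx a' b') c')^T =
  block_mx (block_mx (dotrv a a')%:M (dotrv a b')%:M (dotrv b a')%:M (dotrv b b')%:M)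
    (col_mx (dotrv a c')%:M (dotrv b c')%:M)
    (row_mx (dotrv c a')%:M (dotrv c b')%:M) (dotrv c c')%:M.
Proof.
rewrite tr_col_mx mul_col_row gram2 mul_col_mx tr_col_mx mul_mx_row.
by rewrite !mulmx_tr_dotrv.
Qed.

Let gram23 (a b a' b' c' : 'rV[R]_5) :
  col_mx a b *m (col_mx (col_mx a' b') c')^T =
  row_mx (block_mx (dotrv a a')%:M (dotrv a b')%:M (dotrv b a')%:M (dotrv b b')%:M)
    (col_mx (dotrv a c')%:M (dotrv b c')%:M).
Proof. by rewrite tr_col_mx mul_mx_row gram2 mul_col_mx !mulmx_tr_dotrv. Qed.

Let scalar0 : (0 : R)%:M = 0 :> 'M[R]_1.
Proof. by apply/matrixP => i j; rewrite !mxE mul0rn. Qed.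

Let Q12 : Q1 *m Q2^T = 0.
Proof.
rewrite gram23 eu ev ex wu wv wx !scalar0.
by rewrite [col_mx 0 0]col_mx0 -[block_mx 0 0 0 0]/(col_mx _ _) row_mx0 col_mx0 row_mx0.
Qed.

Let QQ : Q *m Q^T = 1%:M.
Proof.
rewrite tr_col_mx mul_col_row Q12.
have -> : Q2 *m Q1^T = 0 by apply: trmx_inj; rewrite trmx_mul trmxK Q12 trmx0.
rewrite gram2 gram3 (dotrvC w e) (dotrvC v u) (dotrvC x u) (dotrvC x v).
rewrite ee ww uu vv xx ew uv ux vx !scalar0 row_mx0 col_mx0.
by rewrite -!scalar_mx_block.
Qed.

(** Parseval for the orthonormal basis [e, w, u, v, x]. *)
Lemma basis5_expand (z : 'rV[R]_5) : z = dotrv z e *: e + dotrv z w *: w +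
  (dotrv z u *: u + dotrv z v *: v + dotrv z x *: x).
Proof.
rewrite -[LHS]mulmx1 -(mulmx1C QQ) mulmxA tr_col_mx mul_mx_row mul_row_col.
rewrite /Q1 /Q2 !tr_col_mx !mul_mx_row !mul_row_col !mulmx_tr_dotrv.
by rewrite !mul_scalar_mx.
Qed.

(** On [span (u, v, x)] the hypothesis says that the upper left block of the
    rotation has the form [[p, q], [-q, p]].  Since its first two rows are
    orthonormal, their entries [r] and [s] on [x] satisfy [r s = 0] and
    [r^2 = s^2], so both vanish; then [x] is an eigenvector, and the determinant
    fixes its eigenvalue. *)
Lemma umbilic_fix (P : 'M[R]_5) ep : P *m P^T = 1%:M -> \det P = 1 ->
  e *m P = ep *: e -> w *m P = w ->
  bil P u u = bil P v v -> bil P u v + bil P v u = 0 -> x *m P = ep *: x.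
Proof.
move=> PP dP eP wP; rewrite /bil => puv quv.
have PT : P^T *m P = 1%:M := mulmx1C PP.
have inv y z : dotrv (y *m P) (z *m P) = dotrv y z by exact: dotrv_mul.
have ep2 : ep * ep = 1.
  by have := inv e e; rewrite eP dotrvZl dotrvZr ee mulr1.
have ep0 : ep != 0 by apply/eqP => ep0; move: ep2; rewrite ep0 mul0r; lra.
have Pe z : dotrv z e = 0 -> dotrv (z *m P) e = 0.
  move=> ze; apply: (mulfI ep0); rewrite mulr0 -dotrvZr -eP inv; exact: ze.
have Pw z : dotrv z w = 0 -> dotrv (z *m P) w = 0.
  by move=> zw; rewrite -wP inv.
have [ue ve xe] : [/\ dotrv u e = 0, dotrv v e = 0 & dotrv x e = 0].
  by split; rewrite dotrvC.
have [uw vw xw] : [/\ dotrv u w = 0, dotrv v w = 0 & dotrv x w = 0].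
  by split; rewrite dotrvC.
set p := dotrv (v *m P) v in puv; set q := dotrv (u *m P) v in quv.
have vq : dotrv (v *m P) u = - q by apply/eqP; rewrite -addr_eq0 addrC quv.
pose r := dotrv (u *m P) x; pose s := dotrv (v *m P) x.
have uP : u *m P = p *: u + q *: v + r *: x.
  by rewrite {1}(basis5_expand (u *m P)) Pe// Pw// puv !scale0r !add0r.
have vP : v *m P = (- q) *: u + p *: v + s *: x.
  by rewrite {1}(basis5_expand (v *m P)) Pe// Pw// vq !scale0r !add0r.
have [vu xu xv] : [/\ dotrv v u = 0, dotrv x u = 0 & dotrv x v = 0].
  by split; rewrite dotrvC.
have dots := (dotrvDl, dotrvDr, dotrvZl, dotrvZr).
have n1 : p ^+ 2 + q ^+ 2 + r ^+ 2 = 1.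
  rewrite -uu -(inv u u) uP !dots uu vv xx uv vu ux xu vx xv; ring.
have n2 : p ^+ 2 + q ^+ 2 + s ^+ 2 = 1.
  rewrite -vv -(inv v v) vP !dots uu vv xx uv vu ux xu vx xv; ring.
have n3 : r * s = 0.
  rewrite -uv -(inv u v) uP vP !dots uu vv xx uv vu ux xu vx xv; ring.
have [r0 s0] : r = 0 /\ s = 0.
  have rs : r ^+ 2 = s ^+ 2 by lra.
  have : r ^+ 2 * s ^+ 2 = 0 by rewrite -exprMn n3 expr0n.
  rewrite {1}rs => /eqP; rewrite mulf_eq0 orbb sqrf_eq0 => /eqP s0; split => //.
  by apply/eqP; rewrite -sqrf_eq0 rs s0 expr0n.
move: uP vP n1; rewrite r0 s0 !scale0r !addr0 expr0n addr0 => uP vP pq.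
pose a := dotrv (x *m P) u; pose b := dotrv (x *m P) v; pose y := dotrv (x *m P) x.
have ab1 : p * a + q * b = 0.
  by rewrite -ux -(inv u x) uP dotrvC !dots.
have ab2 : - q * a + p * b = 0.
  by rewrite -vx -(inv v x) vP dotrvC !dots.
have a0 : a = 0.
  have : p * (p * a + q * b) - q * (- q * a + p * b) = (p ^+ 2 + q ^+ 2) * a by ring.
  by rewrite ab1 ab2 pq !mulr0 subr0 mul1r => <-.
have b0 : b = 0.
  have : q * (p * a + q * b) + p * (- q * a + p * b) = (p ^+ 2 + q ^+ 2) * b by ring.
  by rewrite ab1 ab2 pq !mulr0 addr0 mul1r => <-.
have xP : x *m P = y *: x.
  rewrite {1}(basis5_expand (x *m P)) Pe// Pw// -/a -/b -/y a0 b0.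
  by rewrite !scale0r !add0r.
rewrite xP; congr (_ *: _).
suff : ep * y = 1 by move=> h; rewrite -[LHS]mul1r -ep2 -mulrA h mulr1.
have Q1P : Q1 *m P = col_mx (ep *: e) w by rewrite mul_col_mx eP wP.
have Q2P : Q2 *m P = col_mx (col_mx (p *: u + q *: v) ((- q) *: u + p *: v)) (y *: x).
  by rewrite !mul_col_mx uP vP xP.
have : \det (Q *m P *m Q^T) = 1.
  by rewrite !det_mulmx mulrAC -det_mulmx QQ det1 mul1r.
rewrite mul_col_mx tr_col_mx mul_col_row.
have -> : Q1 *m P *m Q2^T = 0.
  rewrite Q1P gram23 dotrvZl dotrvZl dotrvZl eu ev ex wu wv wx !mulr0 !scalar0.
  by rewrite [col_mx 0 0]col_mx0 -[block_mx 0 0 0 0]/(col_mx _ _) row_mx0 col_mx0 row_mx0.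
rewrite det_lblock Q1P Q2P gram2 gram3 !dots.
rewrite ee ew (dotrvC w e) ew ww uu vv xx uv vu ux vx xu xv !mulr0 !addr0 !add0r !mulr1.
rewrite !scalar0 det_ublock !det_scalar1 mulr1 row_mx0 col_mx0 det_ublock det_scalar1.
have -> : \det (block_mx p%:M q%:M (- q)%:M p%:M : 'M[R]_(1 + 1)) = 1.
  by rewrite det_block11 mulrN opprK -!expr2.
by rewrite !mul1r.
Qed.

End Basis5.

(** * Star bodies *)

Section StarBody.
Variables (R : realType) (n : nat).
Implicit Types (K : set 'rV[R]_n) (x y z : 'rV[R]_n).

Lemma star_bodyZ K x t : star_body K -> K x -> 0 <= t <= 1 -> K (t *: x).
Proof.
move=> [_ [_ star] _] Kx t01; apply: (star x Kx); exists t => //.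
by rewrite scaler0 add0r.
Qed.

Lemma star_body_closed K : star_body K -> closed K.
Proof. by move=> [[Kc _ _] _ _]; apply: compact_closed Kc; exact: norm_hausdorff. Qed.

Lemma star_body0 K : star_body K -> K 0.
Proof. by move=> [_ [/interior_subset]]. Qed.

Lemma star_body_bounded_ray K x : star_body K -> x != 0 ->
  has_sup [set c : R | K (c *: x)].
Proof.
move=> sK x0; split; first by exists 0; rewrite /= scale0r; exact: star_body0.
have [[Kc _ _] _ _] := sK; have [M [_ KM]] := compact_bounded Kc.
have x0' : 0 < `|x| by rewrite normr_gt0.
exists ((`|M| + 1) / `|x|) => c /= Kcx.
rewrite ler_pdivlMr//; apply: le_trans (KM (`|M| + 1) _ _ Kcx); last first.
  by rewrite (le_lt_trans (ler_norm _))// ltrDl.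
by rewrite normrZ ler_wpM2r// ler_norm.
Qed.

(** The radial function is continuous and exceeds [1] at [t x], hence near it. *)
Lemma star_body_interior K x t : star_body K -> K x -> 0 <= t < 1 ->
  interior K (t *: x).
Proof.
move=> sK Kx /andP[t0 t1]; have [_ [K0 star] rhoc] := sK.
have [->|tn0] := eqVneq t 0; first by rewrite scale0r.
have [->|x0] := eqVneq x 0; first by rewrite scaler0.
have tgt0 : 0 < t by rewrite lt_neqAle eq_sym tn0.
have tx0 : t *: x != 0 by rewrite scaler_eq0 negb_or tn0.
have rho1 : 1 < radial K (t *: x).
  apply: (@lt_le_trans _ _ t^-1); first by rewrite invf_gt1.
  apply: sup_ubound; first by case: (star_body_bounded_ray sK tx0).
  by rewrite /= scalerA mulVf// scale1r.
have op : open [set x : 'rV[R]_n | x != 0].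
  have -> : [set x : 'rV[R]_n | x != 0] = ~` [set 0].
    by apply/seteqP; split=> y /= /eqP.
  apply: closed_openC; apply: compact_closed; first exact: norm_hausdorff.
    exact: compact_set1.
move: rhoc; rewrite continuous_open_subspace// => /(_ (t *: x)).
rewrite inE /= => /(_ tx0) /(_ [set r | 1 < r]) near1.
have {}near1 : \forall y \near t *: x, 1 < radial K y.
  by apply: near1; apply: open_nbhs_nbhs; split; [exact: open_gt|].
have near0 : \forall y \near t *: x, y != 0 by apply: open_nbhs_nbhs.
rewrite /interior; apply: filterS2 near1 near0 => y y1 y0.
have [c /= Kc c1] := @sup_gt _ [set c : R | K (c *: y)] 1
  (proj1 (star_body_bounded_ray sK y0)) y1.
have c0 : 0 < c by apply: lt_trans c1.
rewrite -[y]scale1r -(@mulVf _ c) ?gt_eqF// -scalerA.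
by apply: star_bodyZ => //; rewrite invr_ge0 ltW//= invf_le1// ltW.
Qed.

End StarBody.

(** * Four-dimensional sections of a five-dimensional space *)

Section Sections5.
Variables (R : realType) (n : nat) (K L : set 'rV[R]_n) (zeta : 'rV[R]_n).
Hypotheses (sK : star_body K) (sL : star_body L).
Hypothesis hcongr : forall H : {vspace 'rV[R]_n}, \dim H = 4%N -> zeta \in H ->
  directly_congruent H (section_by K H) (section_by L H).
Hypothesis hSO4 : forall H : {vspace 'rV[R]_n}, \dim H = 4%N -> zeta \in H ->
  ~ has_SO_symmetry H (section_by K H).

(** Coordinates with respect to the frame [B] below; [e5] is [zeta]. *)
Definition e5 : 'rV[R]_5 := delta_mx 0 0.

Variable B : 'M[R]_(5, n).
Hypotheses (BB : B *m B^T = 1%:M) (eB : e5 *m B = zeta).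

Lemma e5e5 : dotrv e5 e5 = 1.
Proof. by rewrite dotrvE trmx_delta mul_delta_mx mxE !eqxx. Qed.

Definition unit_perp (w : 'rV[R]_5) := dotrv w w = 1 /\ dotrv e5 w = 0.

Lemma unit_perp_complement w : unit_perp w -> exists C : 'M[R]_(4, 5),
  [/\ w *m w^T = 1%:M, C *m C^T = 1%:M, w *m C^T = 0,
   (C *m B) *m (C *m B)^T = 1%:M & zeta \in rowvs (C *m B)].
Proof.
move=> [ww ew]; have ww1 : w *m w^T = 1%:M by rewrite mulmx_tr_dotrv ww.
have [C [CC wC _]] := @orthonormal_extend R 4 1 5 w 0 ww1 isT.
exists C; split => //.
  by rewrite trmx_mul mulmxA -(mulmxA C) BB mulmx1.
apply/mem_rowvs; exists (e5 *m C^T).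
by rewrite mulmxA (complementK (w := w)).
Qed.

(** The rotation of the section is extended to fix [w], so that rotations for
    different [w] live in the same matrix group and can be compared. *)
Lemma congruence5 w : unit_perp w -> exists (P : 'M[R]_5) (a : 'rV[R]_5),
  [/\ P *m P^T = 1%:M, \det P = 1, w *m P = w, dotrv a w = 0 &
   forall c, dotrv c w = 0 -> (K (c *m B) <-> L ((c *m P - a) *m B))].
Proof.
move=> uw; have [C [ww CC wC AA zA]] := unit_perp_complement uw.
have [P [a [PP dP E]]] :=
  directly_congruent_frame AA (hcongr (dim_rowvs AA) zA).
exists (fix_ext w C P), (a *m C); split.
- exact: fix_ext_orth.
- by rewrite fix_ext_det.
- exact: fix_ext_w.
- exact: complement_ortho.
move=> c cw; rewrite -[c](complementK ww CC wC)// fix_ext_compl//.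
by rewrite -mulmxBl -!(mulmxA _ C B); exact: E.
Qed.

Lemma no_symmetry5 w P a : unit_perp w -> P *m P^T = 1%:M -> \det P = 1 ->
  w *m P = w -> dotrv a w = 0 ->
  (forall c, dotrv c w = 0 -> (K (c *m B) <-> K ((c *m P - a) *m B))) ->
  P = 1%:M.
Proof.
move=> uw PP dP wP aw E; have [C [ww CC wC AA zA]] := unit_perp_complement uw.
have PK := fix_extK ww CC wC PP wP.
have Cw : C *m w^T = 0 by apply: trmx_inj; rewrite trmx_mul trmxK wC trmx0.
have CPC1 : C *m P *m C^T = 1%:M.
  apply: (no_SO_symmetry_frame AA (hSO4 (dim_rowvs AA) zA) (a := a *m C^T)).
  - have Pw : P *m w^T = w^T.
      apply: trmx_inj; rewrite trmx_mul trmxK.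
      by rewrite -{1}wP -mulmxA PP mulmx1.
    rewrite !trmx_mul trmxK !mulmxA -(mulmxA _ C^T C).
    have -> : C^T *m C = 1%:M - w^T *m w.
      by rewrite -(complement_resolution ww CC wC) addrAC subrr add0r.
    rewrite mulmxBr mulmx1 mulmxBl !mulmxA -(mulmxA C P w^T) Pw Cw !mul0mx subr0.
    by rewrite -(mulmxA C P) PP mulmx1.
  - by rewrite -(fix_ext_det ww CC wC) PK.
  move=> c; rewrite mulmxA E; last exact: complement_ortho wC c.
  suff -> : c *m C *m P - a = (c *m (C *m P *m C^T) - a *m C^T) *m C
    by rewrite -(mulmxA _ C B).
  rewrite mulmxBl (complementK ww CC wC aw); congr (_ - _).
  by rewrite -(fix_ext_compl CC wC) PK.
by rewrite -PK CPC1 /fix_ext mulmx1; exact: complement_resolution.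
Qed.

End Sections5.

(** * Chords and diameters on the axis *)

Section Axis.
Variables (R : realType) (n : nat).
Implicit Types (K : set 'rV[R]_n) (zeta : 'rV[R]_n).

(** A line through the origin meets a set star-shaped at the origin in an
    interval. *)
Lemma star_body_axis K zeta s t u : star_body K -> K (s *: zeta) -> K (t *: zeta) ->
  s <= u <= t -> K (u *: zeta).
Proof.
move=> sK Ks Kt /andP[su ut].
have toward r : r != 0 -> K (r *: zeta) -> 0 <= u / r <= 1 -> K (u *: zeta).
  move=> r0 Kr ur; have := star_bodyZ sK Kr ur.
  by rewrite scalerA divfK.
have [u0|u0|->] := ltgtP u 0; last by rewrite scale0r; exact: star_body0.
  have s0 : s < 0 by exact: le_lt_trans u0.
  apply: (toward s) => //; first by rewrite lt_eqF.
  apply/andP; split; first by rewrite mulr_le0// ?invr_le0 ltW.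
  by rewrite ler_ndivrMr// mul1r.
have t0 : 0 < t by exact: lt_le_trans ut.
apply: (toward t) => //; first by rewrite gt_eqF.
apply/andP; split; first by rewrite divr_ge0 ?(ltW u0) ?(ltW t0).
by rewrite ler_pdivrMr// mul1r.
Qed.

Lemma segment_axis zeta s t z :
  segment (s *: zeta) (t *: zeta) z -> s <= t -> exists2 u, s <= u <= t & z = u *: zeta.
Proof.
move=> [r /= /andP[r0 r1] <-] st; exists ((1 - r) * s + r * t).
  by apply/andP; split; nra.
by rewrite !scalerA -scalerDl.
Qed.

Lemma diameter_axis K zeta : star_body K -> enorm zeta = 1 ->
  has_diameter_along K zeta ->
  exists al d, [/\ 0 < d, forall t, al <= t <= al + d -> K (t *: zeta)
    & forall a b, segment a b `<=` K -> enorm (a - b) <= d].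
Proof.
move=> sK z1 [z [y [[zyK zymax] [c zyc] [t /= /andP[t0 t1] zy0]]]].
have zE : z = (t * c) *: zeta.
  rewrite -scalerA -zyc -[z in LHS]subr0 -zy0.
  by apply/rowP => i; rewrite !mxE; ring.
have yE : y = ((t - 1) * c) *: zeta.
  by rewrite mulrBl mul1r scalerBl -zE -zyc opprB addrC subrK.
have dE : enorm (z - y) = `|c| by rewrite zyc enormZ z1 mulr1.
have c0 : 0 < `|c|.
  rewrite -dE; have [_ [K0 _] _] := sK.
  have cz : {for 0 : R, continuous (fun s : R => s *: zeta)} by exact: scalel_continuous.
  have [s s0 Ks] : exists2 s : R, 0 < s & K (s *: zeta).
    have /nbhs_ballP[e /= e0 eK] : nbhs (0 : R) [set s : R | K (s *: zeta)].
      by apply: cz; rewrite scale0r.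
    exists (e / 2); first by rewrite divr_gt0.
    by apply: eK; rewrite /ball /= sub0r normrN gtr0_norm ?divr_gt0//; lra.
  apply: (@lt_le_trans _ _ s) => //.
  have -> : s = enorm (s *: zeta - 0 *: zeta).
    by rewrite scale0r subr0 enormZ z1 mulr1 gtr0_norm.
  apply: zymax => x [r r01 <-]; rewrite scale0r scaler0 addr0.
  apply: star_bodyZ => //; move: r01 => /= /andP[r0 r1].
  by apply/andP; split; lra.
have [Kz Ky] : K z /\ K y.
  split; apply: zyK; [exists 0|exists 1].
  - by rewrite /= lexx ler01.
  - by rewrite subr0 scale1r scale0r addr0.
  - by rewrite /= lexx ler01.
  - by rewrite subrr scale0r scale1r add0r.
rewrite zE in Kz; rewrite yE in Ky.
have [cp|cn|c00] := ltgtP c 0; last by rewrite c00 normr0 ltxx in c0.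
  exists (t * c), `|c|; split => //; last by rewrite -dE.
  move=> u ur; apply: (star_body_axis sK Kz Ky).
  by move: ur; rewrite ltr0_norm//; lra.
exists ((t - 1) * c), `|c|; split => //; last by rewrite -dE.
move=> u ur; apply: (star_body_axis sK Ky Kz).
by move: ur; rewrite gtr0_norm//; lra.
Qed.

(** Two different chords of maximal length [d] on the same line would span a
    longer one. *)
Lemma axis_chord_unique K zeta d : star_body K -> enorm zeta = 1 -> 0 < d ->
  (forall a b, segment a b `<=` K -> enorm (a - b) <= d) ->
  exists la, forall s, K (s *: zeta) -> K ((s + d) *: zeta) -> s = la.
Proof.
move=> sK z1 d0 dmax.
have lt_absurd s t : K (s *: zeta) -> K ((t + d) *: zeta) -> s < t -> False.
  move=> Ks Kt st; have : enorm ((t + d) *: zeta - s *: zeta) <= d.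
    rewrite -[X in enorm X]opprB -scaleN1r enormZ normrN1 mul1r.
    apply: dmax => x /segment_axis[|u ur ->]; first by lra.
    exact: (star_body_axis sK Ks Kt).
  by rewrite -scalerBl enormZ z1 mulr1 gtr0_norm; lra.
have [[la [la1 la2]]|no] := pselect (exists s, K (s *: zeta) /\ K ((s + d) *: zeta)).
  exists la => s Ks1 Ks2; 
  by have [/(lt_absurd _ _ Ks1 la2)|/(lt_absurd _ _ la1 Ks2)|] := ltgtP s la.
by exists 0 => s Ks1 Ks2; exfalso; apply: no; exists s.
Qed.

End Axis.

(** * A curve that meets hyperplanes finitely often *)

Section GenericCurve.
Variable R : realType.

Lemma finite_roots (p : {poly R}) : p != 0 -> finite_set [set s | root p s].
Proof.
move=> p0; apply: contrapT => /(infinite_set_fset (size p)) [B Bp sB].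
have := @max_poly_roots _ p (finmap.enum_fset B) p0.
rewrite ltnNge sB => H; suff : false by []; apply: H; last exact: finmap.fset_uniq.
by apply/allP => s sB'; exact: (Bp s sB').
Qed.

(** Countable sets have Lebesgue measure zero. *)
Lemma near0_notin_countable (A U : set R) : countable A -> nbhs 0 U ->
  exists2 s, U s & ~ A s.
Proof.
move=> cA /nbhs_ballP[r /= r0 rU]; apply: contrapT => noS.
have UA : `]- r, r[ `<=` A.
  move=> s /=; rewrite in_itv/= => sr; apply: contrapT => nA; apply: noS.
  by exists s => //; apply: rU; rewrite /ball/= sub0r normrN ltr_norml.
have := countable_lebesgue_measure0 (sub_countable (subset_card_le UA) cA).
rewrite lebesgue_measure_itv/= lte_fin gtrN// => /eqP; rewrite -EFinB eqe opprK.
by rewrite gt_eqF// addr_gt0.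
Qed.

(** The moment curve in the hyperplane orthogonal to [e5]: a linear form that
    does not vanish there is a nonzero polynomial along the curve. *)
Definition moment (s : R) : 'rV[R]_5 :=
  \row_(i < 5) (if i == 0 then 0 else s ^+ i).

Lemma finite_perp_moment (c w0 : 'rV[R]_5) :
  (exists2 i, i != 0 & c 0 i != 0) ->
  finite_set [set s | dotrv c (w0 + moment s) = 0].
Proof.
move=> [i i0 ci].
pose p := \poly_(j < 5) (if j == 0%N then dotrv c w0 else c 0 (inord j)).
have pE s : p.[s] = dotrv c (w0 + moment s).
  rewrite horner_poly dotrvDr big_ord_recl /= expr0 mulr1; congr (_ + _).
  rewrite [RHS]/dotrv [RHS]big_ord_recl mxE eqxx mulr0 add0r; apply: eq_bigr => j _.
  rewrite mxE /=; congr (c 0 _ * _).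
  by apply: val_inj; rewrite /= inordK// ltnS.
have p0 : p != 0.
  apply: contra_neq ci => /polyP/(_ i); rewrite coef_poly coef0 ltn_ord.
  by rewrite (negbTE (i0 : (i : nat) != 0%N)) inord_val.
apply: sub_finite_set (finite_roots p0) => s /= sE.
by rewrite /root pE sE.
Qed.

(** The curve is brought back to the unit sphere, on which [w] is to vary. *)
Lemma cvg_normalised_moment (w0 : 'rV[R]_5) : dotrv w0 w0 = 1 ->
  (Num.sqrt (dotrv (w0 + moment s) (w0 + moment s)))^-1 *: (w0 + moment s)
    @[s --> (0 : R)] --> w0.
Proof.
move=> w1; have m0 : moment 0 = 0.
  apply/rowP => i; rewrite !mxE; case: eqP => // /eqP i0.
  by rewrite expr0n (negbTE (i0 : (i : nat) != 0%N)).
have em : econt (fun s : R => w0 + moment s).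
  apply: econt_add; first exact: econt_cst.
  move=> i j; under eq_fun do rewrite mxE.
  by case: eqP => _; [exact: cont_cst|apply: cont_exp; exact: cont_id].
have cd := cont_dotrv em em.
have E0 : w0 = (Num.sqrt (dotrv (w0 + moment 0) (w0 + moment 0)))^-1 *: (w0 + moment 0).
  by rewrite m0 addr0 w1 sqrtr1 invr1 scale1r.
rewrite [X in _ --> X]E0; apply: cvgZ; last exact: (econt_continuous em).
apply: cvgV; first by rewrite m0 addr0 w1 sqrtr1 oner_eq0.
by apply: (cont_comp cd); exact: sqrt_continuous.
Qed.

End GenericCurve.

(** * The normalised congruences *)

Lemma dotrv_e5 (R : realType) (w : 'rV[R]_5) : dotrv (e5 R) w = w 0 0.
Proof. by rewrite dotrvE -rowE !mxE. Qed.

Lemma segment_affine (R : realType) k n (P : 'M[R]_(k, n)) (a : 'rV[R]_k)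
    (x y : 'rV[R]_k) z :
  segment ((x - a) *m P) ((y - a) *m P) z ->
  exists2 t, 0 <= t <= 1 & z = ((1 - t) *: x + t *: y - a) *m P.
Proof.
move=> [t t01 <-]; exists t => //.
rewrite !scalemxAl -mulmxDl; congr (_ *m P).
by apply/rowP => i; rewrite !mxE; ring.
Qed.

Section FiveDim.
Variables (R : realType) (n : nat) (K L : set 'rV[R]_n) (zeta : 'rV[R]_n).
Hypotheses (sK : star_body K) (sL : star_body L).
Hypothesis z1 : enorm zeta = 1.
Hypothesis hcongr : forall H : {vspace 'rV[R]_n}, \dim H = 4%N -> zeta \in H ->
  directly_congruent H (section_by K H) (section_by L H).
Hypothesis hSO4 : forall H : {vspace 'rV[R]_n}, \dim H = 4%N -> zeta \in H ->
  ~ has_SO_symmetry H (section_by K H).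
Hypothesis cL : countable (diameters L).
(* [al, al + d] is the chord of K on the axis, and la is the lower end of any
   chord of L of length d on the axis. *)
Variables (al la d : R).
Hypothesis d0 : 0 < d.
Hypothesis Kaxis : forall t, al <= t <= al + d -> K (t *: zeta).
Hypothesis Kdiam : forall a b, segment a b `<=` K -> enorm (a - b) <= d.
Hypothesis Llow : forall s, L (s *: zeta) -> L ((s + d) *: zeta) -> s = la.

Section Frame5.
Variable B : 'M[R]_(5, n).
Hypotheses (BB : B *m B^T = 1%:M) (eB : e5 R *m B = zeta).

Local Notation e := (e5 R).

Lemma coordB_inj (x y : 'rV[R]_5) : x *m B = y *m B -> x = y.
Proof. by move=> xy; rewrite -(mul_frameK BB x) xy mul_frameK. Qed.

(** The chord lies in the section by [w^perp], and the congruence carries it back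
    to a chord of [K]. *)
Lemma chord_le5 (w p q : 'rV[R]_5) : unit_perp w -> dotrv p w = 0 -> dotrv q w = 0 ->
  segment (p *m B) (q *m B) `<=` L -> enorm (p *m B - q *m B) <= d.
Proof.
move=> uw pw qw pqL; have [P [a [PP dP wP aw E]]] := congruence5 hcongr BB eB uw.
have PV := mulmx1C PP.
have wP' : w *m P^T = w by rewrite -{1}wP -mulmxA PP mulmx1.
pose lift x := (x + a) *m P^T.
have liftP x : lift x *m P - a = x by rewrite -mulmxA PV mulmx1 addrK.
have lift_w x : dotrv x w = 0 -> dotrv (lift x) w = 0.
  by move=> xw; rewrite -wP' dotrv_mul ?trmxK// dotrvDl xw aw addr0.
have dist : enorm (p *m B - q *m B) = enorm (lift p *m B - lift q *m B).
  by rewrite -!mulmxBl !enorm_mul ?trmxK// opprD addrACA subrr addr0.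
rewrite dist; apply: Kdiam => z.
rewrite -[lift p]subr0 -[lift q]subr0 => /segment_affine[t t01 ->].
rewrite subr0; apply/E.
  by rewrite dotrvDl !dotrvZl !lift_w// !mulr0 addr0.
apply: pqL; exists t => //; rewrite !scalemxAl -mulmxDl; congr (_ *m B).
rewrite mulmxDl -!scalemxAl -{1}(liftP p) -{1}(liftP q).
by apply/rowP => i; rewrite !mxE; ring.
Qed.

Hypothesis Ldiam : forall a b, segment a b `<=` L -> enorm (a - b) <= d.

Definition generic (w : 'rV[R]_5) := forall D, diameters L D ->
  D `<=` [set z | exists2 c, dotrv c w = 0 & z = c *m B] ->
  D `<=` [set z | exists t, z = t *: zeta].

(** The congruences in normal form.  The entry [P 0 0] is the sign by which [P]
    acts on the axis, and the translation matches the midpoints [al + d / 2] and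
    [la + d / 2] of the chords of [K] and [L] on the axis; a single formula for
    both signs keeps the condition closed. *)
Definition motion (w : 'rV[R]_5) (P : 'M[R]_5) :=
  [/\ P *m P^T = 1%:M, \det P = 1, w *m P = w, e *m P = P 0 0 *: e &
   forall c, dotrv c w = 0 ->
     (K (c *m B) <-> L ((c *m P - (P 0 0 * (al + d / 2) - (la + d / 2)) *: e) *m B))].

(** The axial chord of [K] goes to a chord of [L] of the same length [d], which is
    a diameter of [L] and therefore lies on the axis; a chord of length [d] there
    is unique by [Llow], so only its orientation is free. *)
Lemma generic_motion w : unit_perp w -> generic w -> exists P, motion w P.
Proof.
move=> uw gw; have [P [a [PP dP wP aw E]]] := congruence5 hcongr BB eB uw.
exists P; have [ww ew] := uw.
have wP' : w *m P^T = w by rewrite -{1}wP -mulmxA PP mulmx1.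
have ePw : dotrv (e *m P) w = 0 by rewrite dotrv_mul_tr wP'.
pose tip t := t *: e *m P - a.
have tip_w t : dotrv (tip t) w = 0.
  by rewrite /tip -scalemxAl -scaleN1r dotrvDl !dotrvZl ePw aw !mulr0 addr0.
have endL t : al <= t <= al + d -> L (tip t *m B).
  move=> tal; rewrite /tip; apply/E; first by rewrite dotrvZl ew mulr0.
  by rewrite -scalemxAl eB; exact: Kaxis.
have seg z : segment (tip al *m B) (tip (al + d) *m B) z ->
    exists2 t, al <= t <= al + d & z = tip t *m B.
  move=> /segment_affine[t /andP[t0 t1] ->]; exists (al + t * d).
    by rewrite lerDl lerD2l mulr_ge0 ?(ltW d0)//= ger_pMl.
  rewrite /tip; congr ((_ - _) *m B); rewrite !scalemxAl -mulmxDl; congr (_ *m P).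
  by apply/rowP => i; rewrite !mxE; ring.
have len : enorm (tip al *m B - tip (al + d) *m B) = d.
  rewrite -mulmxBl enorm_mul// /tip opprB addrA subrK -mulmxBl enorm_mul//.
  rewrite -scalerBl enormZ /enorm e5e5 sqrtr1 mulr1.
  by rewrite opprD addrA subrr add0r normrN gtr0_norm.
have diam : diameters L (segment (tip al *m B) (tip (al + d) *m B)).
  exists (tip al *m B), (tip (al + d) *m B); split => //; split.
    by move=> z /seg[t tal ->]; exact: endL.
  by move=> p q pq; rewrite len; exact: Ldiam.
have axis t : t = al \/ t = al + d -> exists s, tip t = s *: e.
  move=> tE; have /(gw _ diam) : segment (tip al *m B) (tip (al + d) *m B)
      `<=` [set z | exists2 c, dotrv c w = 0 & z = c *m B].
    by move=> z /seg[u _ ->]; exists (tip u).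
  case/(_ (tip t *m B)); last first.
    move=> s sE; exists s; apply: coordB_inj; rewrite sE -scalemxAl eB //.
  case: tE => ->.
    by exists 0; rewrite /= ?lexx ?ler01// subr0 scale1r scale0r addr0.
  by exists 1; rewrite /= ?lexx ?ler01// subrr scale1r scale0r add0r.
have [s sE] := axis al (or_introl erefl).
have [s' s'E] := axis (al + d) (or_intror erefl).
have eP : e *m P = ((s' - s) / d) *: e.
  apply: (scalerI (_ : d != 0)); first by rewrite gt_eqF.
  rewrite scalerA mulrC divfK ?gt_eqF// scalerBl -sE -s'E /tip.
  rewrite -!scalemxAl; move: (e *m P) => y.
  by apply/rowP => i; rewrite !mxE; ring.
set ep := (s' - s) / d in eP.
have e00 : e 0 0 = 1 by rewrite mxE !eqxx.
have P00 : P 0 0 = ep.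
  have := congr1 (fun x : 'rV_5 => x 0 0) eP; rewrite -rowE !mxE.
  by rewrite !eqxx mulr1.
have ep2 : ep * ep = 1.
  have := dotrv_mul e e PP; rewrite eP dotrvZl dotrvZr e5e5 mulr1.
  by [].
have aE : a = (ep * al - s) *: e.
  rewrite scalerBl -sE /tip -scalemxAl eP scalerA mulrC opprB.
  by rewrite addrC subrK.
have sd : ep * d = s' - s by rewrite divfK// gt_eqF.
have Ls : L (s *: zeta).
  by rewrite -eB scalemxAl -sE; apply: endL; rewrite ?lexx lerDl ltW.
have Ls' : L (s' *: zeta).
  by rewrite -eB scalemxAl -s'E; apply: endL; rewrite lexx lerDl ltW.
(* ep = 1 keeps the orientation of the chord, ep = -1 reverses it *)
have cE : (P 0 0 * (al + d / 2) - (la + d / 2)) *: e = a.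
  rewrite aE P00; congr (_ *: e).
  have : (ep - 1) * (ep + 1) = 0 by rewrite mulrBl mulrDr ep2; ring.
  move=> /eqP; rewrite mulf_eq0 subr_eq0 addr_eq0 => /orP[] /eqP epE.
    have : s = la by apply: Llow => //; have -> : s + d = s' by move: sd; rewrite epE; lra.
    by move=> <-; rewrite epE; lra.
  have : s' = la by apply: Llow => //; have -> : s' + d = s by move: sd; rewrite epE; lra.
  by move: sd; rewrite epE; lra.
by split => //; [rewrite P00|move=> c cw; rewrite cE; exact: E].
Qed.

(** Along the moment curve through [w0] each diameter off the axis excludes
    finitely many parameters, so all of them together exclude countably many. *)
Lemma generic_dense w0 (U : set 'rV[R]_5) : unit_perp w0 -> nbhs w0 U ->
  exists w, [/\ U w, unit_perp w & generic w].
Proof.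
move=> [ww0 ew0] Uw0.
pose off := [set D | diameters L D /\ ~ (D `<=` [set z | exists t, z = t *: zeta])].
pose bad D := [set s : R |
  D `<=` [set z | exists2 c, dotrv c (w0 + moment s) = 0 & z = c *m B]].
have fin_bad D : off D -> finite_set (bad D).
  move=> [_ /existsNP[z /not_implyP[Dz zoff]]].
  have [i0|noi] := pselect (exists2 i, i != 0 & (z *m B^T) 0 i != 0).
    apply: sub_finite_set (finite_perp_moment w0 i0) => s /(_ z Dz) [c cs zc] /=.
    by rewrite zc mul_frameK.
  have -> : bad D = set0; last exact: finite_set0.
  apply/seteqP; split => // s /(_ z Dz) [c cs zc]; apply: zoff.
  exists (c 0 0); rewrite zc -eB scalemxAl; congr (_ *m B).
  apply/rowP => i; rewrite !mxE eqxx /=.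
  have [->|i0] := eqVneq i 0; first by rewrite mulr1.
  rewrite mulr0; apply/eqP; apply: contrapT => /negP ci; apply: noi.
  by exists i => //; rewrite zc mul_frameK.
have cbad : countable (\bigcup_(D in off) bad D).
  apply: bigcup_countable; last by move=> D /fin_bad/finite_set_countable.
  by apply: sub_countable cL; apply: subset_card_le => D [].
have U0 : nbhs w0 (U `&` [set w | dotrv w w != 0]).
  have cd : continuous (fun w : 'rV[R]_5 => dotrv w w).
    by apply: cont_dotrv; apply: continuous_econt; exact: cont_id.
  apply: filterI => //; apply: (cd w0 [set r | r != 0]).
  by apply: open_nbhs_nbhs; split; [exact: open_neq|rewrite /= ww0 oner_eq0].
(* the nonvanishing condition keeps the curve away from the origin *)
have [s [Us s1] sbad] := near0_notin_countable cbad (cvg_normalised_moment ww0 U0).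
set w' := w0 + moment s in Us s1.
have w'0 : 0 < dotrv w' w'.
  rewrite lt_neqAle dotrv_ge0 andbT eq_sym; apply/eqP => /dotrv_eq0 w'0.
  by move: s1; rewrite /= w'0 scaler0 dotrv0 eqxx.
set k := (Num.sqrt (dotrv w' w'))^-1 in Us.
have k0 : k != 0 by rewrite invr_eq0 gt_eqF// sqrtr_gt0.
exists (k *: w'); split => //.
  split.
    rewrite dotrvZl dotrvZr mulrA -expr2 exprVn sqr_sqrtr ?ltW//.
    by rewrite mulVf// gt_eqF.
  rewrite dotrvZr dotrv_e5 !mxE eqxx addr0.
  by move: ew0; rewrite dotrv_e5 => ->; rewrite mulr0.
move=> D dD DH; apply: contrapT => Doff; apply: sbad; exists D => //.
move=> z /DH[c ck zc]; exists c => //.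
by move/eqP: ck; rewrite dotrvZr mulf_eq0 (negbTE k0) => /eqP.
Qed.

Definition motion_graph := [set p : 'rV[R]_5 * 'M[R]_5 | unit_perp p.1 /\ motion p.1 p.2].

(** Replacing a condition on all [c] orthogonal to [w] by one on [perp_part w c]
    for all [c] removes the dependence of the quantifier on [w]. *)
Definition perp_part (w c : 'rV[R]_5) := c - dotrv c w *: w.

Definition shift (P : 'M[R]_5) := (P 0 0 * (al + d / 2) - (la + d / 2)) *: e.

Lemma perp_partP w c : unit_perp w -> dotrv (perp_part w c) w = 0.
Proof.
move=> [ww _]; rewrite /perp_part -scaleN1r scalerA dotrvDl dotrvZl ww.
by rewrite mulr1 mulN1r subrr.
Qed.

Lemma perp_part_id w c : dotrv c w = 0 -> perp_part w c = c.
Proof. by rewrite /perp_part => ->; rewrite scale0r subr0. Qed.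

Lemma shift_perp w P : unit_perp w -> dotrv (shift P) w = 0.
Proof. by move=> [_ ew]; rewrite dotrvZl ew mulr0. Qed.

Lemma closed_at_left1 (F : R -> 'rV[R]_n) (A : set 'rV[R]_n) : closed A ->
  continuous F -> (forall t, 0 <= t < 1 -> A (F t)) -> A (F 1).
Proof.
move=> cA cF AF; apply: (@closed_cvg _ _ (1 : R)^'- _ F A) => //.
  near=> t; apply: AF; apply/andP; split; near: t.
    by apply: nbhs_left_ge; exact: ltr01.
  exact: nbhs_left_lt.
by apply: cvg_at_left_filter; exact: cF.
Unshelve. all: by end_near. Qed.

(** Interior points form an open set, which makes the hypotheses closed conditions
    on [(w, P)].  Nothing is lost: a point of a star body is the limit of the
    points [t x] with [t < 1], which are interior. *)
Lemma motion_radial w P : unit_perp w -> P *m P^T = 1%:M ->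
  (forall c, interior K (perp_part w c *m B) ->
     L ((perp_part w c *m P - shift P) *m B)) ->
  (forall c, interior L (perp_part w c *m B) ->
     K ((perp_part w c + shift P) *m P^T *m B)) ->
  w *m P = w ->
  forall c, dotrv c w = 0 -> (K (c *m B) <-> L ((c *m P - shift P) *m B)).
Proof.
move=> uw PP KL LK wP c cw; split=> [Kc|Lc].
  rewrite -[c]scale1r; apply: (closed_at_left1
    (F := fun t : R => (t *: c *m P - shift P) *m B)) (star_body_closed sL) _ _.
    by apply: econt_continuous; econt.
  move=> t t01; rewrite -(perp_part_id (w := w) (c := t *: c)) ?dotrvZl ?cw ?mulr0//.
  apply: KL; rewrite perp_part_id ?dotrvZl ?cw ?mulr0// -scalemxAl.
  exact: star_body_interior.
set y := c *m P - shift P in Lc.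
have yw : dotrv y w = 0.
  rewrite /y -scaleN1r dotrvDl dotrvZl (shift_perp _ uw) mulr0 addr0.
  by rewrite -[w in dotrv _ w]wP dotrv_mul.
have -> : c = (1 *: y + shift P) *m P^T.
  by rewrite scale1r /y subrK -mulmxA PP mulmx1.
apply: (closed_at_left1 (F := fun t : R => (t *: y + shift P) *m P^T *m B))
  (star_body_closed sK) _ _.
  by apply: econt_continuous; econt.
move=> t t01; rewrite -(perp_part_id (w := w) (c := t *: y)) ?dotrvZl ?yw ?mulr0//.
apply: LK; rewrite perp_part_id ?dotrvZl ?yw ?mulr0// -scalemxAl.
exact: star_body_interior.
Qed.

Lemma closed_motion_graph : closed motion_graph.
Proof.
have -> : motion_graph = [set p | dotrv p.1 p.1 = 1] `&` [set p | dotrv e p.1 = 0] `&`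
    [set p | p.2 *m p.2^T = 1%:M] `&` [set p | \det p.2 = 1] `&`
    [set p | p.1 *m p.2 = p.1] `&` [set p | e *m p.2 = p.2 0 0 *: e] `&`
    [set p | forall c, interior K (perp_part p.1 c *m B) ->
       L ((perp_part p.1 c *m p.2 - shift p.2) *m B)] `&`
    [set p | forall c, interior L (perp_part p.1 c *m B) ->
       K ((perp_part p.1 c + shift p.2) *m p.2^T *m B)].
  apply/seteqP; split=> [[w P] [[ww ew] [PP dP wP eP E]]|[w P]].
    have uw : unit_perp w by [].
    split; last first.
      move=> c cint; have Lc := interior_subset cint; apply/E.
        by rewrite dotrv_mul_tr trmxK wP dotrvDl perp_partP// shift_perp// addr0.
      by rewrite -mulmxA (mulmx1C PP) mulmx1 addrK.
    split; last first.
      by move=> c cint; apply/E; [exact: perp_partP|exact: interior_subset].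
    by do !split.
  move=> [[[[[[[ww ew] PP] dP] wP] eP] KL] LK]; split => //; split => //.
  by apply: motion_radial => //; split.
have e1 : econt (fun p : 'rV[R]_5 * 'M[R]_5 => p.1).
  by apply: continuous_econt; exact: cont_fst.
have e2 : econt (fun p : 'rV[R]_5 * 'M[R]_5 => p.2).
  by apply: continuous_econt; exact: cont_snd.
have c2 := e2 0 0.
have eperp c : econt (fun p : 'rV[R]_5 * 'M[R]_5 => perp_part p.1 c).
  by rewrite /perp_part; econt.
have eshift : econt (fun p : 'rV[R]_5 * 'M[R]_5 => shift p.2).
  by rewrite /shift; econt.
do 7?[apply: closedI].
- by apply: closed_eqfun; econt.
- by apply: closed_eqfun; econt.
- by apply: closed_eqmx; econt.
- apply: closed_eqfun; last exact: cont_cst.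
  apply: cont_sum => s; apply: cont_mul; first exact: cont_cst.
  by apply: continuous_big => //; exact: mul_continuous.
- by apply: closed_eqmx; econt.
- by apply: closed_eqmx; econt.
- apply: closed_forall => c; apply: closed_imply; last exact: star_body_closed.
  + by apply: econt_continuous; econt.
  + by apply: econt_continuous; econt.
  + exact: open_interior.
- apply: closed_forall => c; apply: closed_imply; last exact: star_body_closed.
  + by apply: econt_continuous; econt.
  + by apply: econt_continuous; econt.
  + exact: open_interior.
Qed.

Lemma compact_motion_graph : compact motion_graph.
Proof.
have unit_box k (x : 'rV[R]_k) i : dotrv x x = 1 -> -1 <= x 0 i <= 1.
  move=> x1; apply: sqr_le1; rewrite -x1 /dotrv (bigD1 i)//= -expr2 lerDl.
  by apply: sumr_ge0 => j _; rewrite -expr2 sqr_ge0.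
apply: (subclosed_compact closed_motion_graph
  (compact_setX (@compact_mx_box R 1 5) (@compact_mx_box R 5 5))).
move=> [v P] [[vv _] [PP _ _ _ _]]; split => /= i j.
  by rewrite ord1; exact: unit_box.
have -> : P i j = row i P 0 j by rewrite mxE.
apply: unit_box; have := congr1 (fun M : 'M[R]_5 => M i i) PP.
by rewrite !mxE eqxx mulr1n => <-; apply: eq_bigr => k _; rewrite !mxE.
Qed.

(** The set of [w] that have a motion is a projection of the compact set
    [motion_graph], hence closed, and it contains the dense set of generic
    [w]. *)
Lemma motion_exists w : unit_perp w -> exists P, motion w P.
Proof.
move=> uw; have : closed (fst @` motion_graph).
  apply: compact_closed; first exact: norm_hausdorff.
  apply: continuous_compact compact_motion_graph.
  by apply: continuous_subspaceT => p; exact: cvg_fst.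
move=> /(_ w) []; last by move=> [v P] [_ vP] /= <-; exists P.
move=> U Uw; have [v [Uv uv gv]] := generic_dense uw Uw.
exists v; split => //; have [P vP] := generic_motion uv gv.
by exists (v, P).
Qed.

(** Composing one motion with the inverse of the other gives a rotational symmetry
    of the section of [K]. *)
Lemma motion_unique w P P' : unit_perp w -> motion w P -> motion w P' -> P = P'.
Proof.
move=> uw [PP dP wP eP E] [PP' dP' wP' eP' E'].
have PV' := mulmx1C PP'.
have wPt : w *m P'^T = w by rewrite -{1}wP' -mulmxA PP' mulmx1.
suff h : P *m P'^T = 1%:M by rewrite -[LHS]mulmx1 -PV' mulmxA h mul1mx.
apply: (no_symmetry5 hSO4 BB eB uw (a := (shift P - shift P') *m P'^T)).
- by rewrite trmx_mul trmxK mulmxA -(mulmxA P) PV' mulmx1.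
- by rewrite det_mulmx det_tr dP dP' mulr1.
- by rewrite mulmxA wP wPt.
- by rewrite dotrv_mul_tr trmxK wP' dotrvDl dotrvNl !shift_perp// subr0.
move=> c cw; rewrite E// -/(shift P).
have -> : c *m (P *m P'^T) - (shift P - shift P') *m P'^T =
    (c *m P - shift P + shift P') *m P'^T.
  by rewrite mulmxA -mulmxBl opprB addrA addrAC.
rewrite E' -/(shift P'); first by rewrite -(mulmxA _ P'^T) PV' mulmx1 addrK.
rewrite dotrv_mul_tr trmxK wP' !dotrvDl dotrvNl !shift_perp// subr0 addr0.
by rewrite dotrv_mul_tr -[X in X *m P^T]wP -mulmxA PP mulmx1.
Qed.

(** Antipodal [w] define the same section. *)
Lemma motion_opp w P : motion w P -> motion (- w) P.
Proof.
move=> [PP dP wP eP E]; split => //; first by rewrite mulNmx wP.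
by move=> c; rewrite -scaleN1r dotrvZr mulN1r => /eqP; rewrite oppr_eq0 => /eqP; exact: E.
Qed.

Lemma motion_sign w P : motion w P -> P 0 0 = 1 \/ P 0 0 = -1.
Proof.
move=> [PP _ _ eP _]; have := dotrv_mul e e PP.
rewrite eP dotrvZl dotrvZr e5e5 mulr1 -expr2 => /eqP.
by rewrite sqrf_eq1 => /orP[] /eqP; [left|right].
Qed.

(** The vectors [w] orthogonal to [e] and [x] are parametrised by the chart
    [stereo], with [w0] at its centre.  By [umbilic_exists] some [w] of the chart
    has an umbilic form, so its motion maps [x] to [x] times the sign on the axis;
    this motion then acts on [span (e, x)] by that sign.  The sign is constant on
    the chart by continuity, so it is the one of [P0]. *)
Lemma plane_sections w0 x P0 : unit_perp w0 -> unit_perp x -> dotrv x w0 = 0 ->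
  motion w0 P0 -> forall s t,
  K ((s *: e + t *: x) *m B) <-> L ((P0 0 0 *: (s *: e + t *: x) - shift P0) *m B).
Proof.
move=> uw0 ux xw0 m0 s t; have [ww0 ew0] := uw0; have [xx ex] := ux.
pose A1 : 'M[R]_(1 + 1 + 1, 5) := col_mx (col_mx e x) w0.
have A1O : A1 *m A1^T = 1%:M.
  rewrite !tr_col_mx mul_col_row mul_col_row mul_col_mx mul_mx_row !mulmx_tr_dotrv.
  rewrite (dotrvC x e) (dotrvC w0 e) (dotrvC w0 x) e5e5 xx ww0 ex ew0 xw0.
  have z0 : (0 : R)%:M = 0 :> 'M[R]_1 by rewrite -scalemx1 scale0r.
  by rewrite !z0 row_mx0 col_mx0 -!scalar_mx_block.
have [C [CC A1C _]] := @orthonormal_extend R 2 (1 + 1 + 1) 5 A1 0 A1O isT.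
move: A1C; rewrite !mul_col_mx => /eqP; rewrite !col_mx_eq0.
move=> /andP[/andP[/eqP eC /eqP xC] /eqP wC].
pose J : 'M[R]_(2 + 1, 5) := col_mx C w0.
have JJ : J *m J^T = 1%:M.
  rewrite tr_col_mx mul_col_row CC wC mulmx_tr_dotrv ww0.
  have -> : C *m w0^T = 0 by apply: trmx_inj; rewrite trmx_mul trmxK wC trmx0.
  by rewrite -scalar_mx_block.
have perpJ y (f : 'rV[R]_3) : y *m C^T = 0 -> dotrv y w0 = 0 -> dotrv y (f *m J) = 0.
  move=> yC yw; have yJ : y *m J^T = 0.
    by rewrite tr_col_mx mul_mx_row yC mulmx_tr_dotrv yw -scalemx1 scale0r row_mx0.
  by rewrite dotrvE trmx_mul mulmxA yJ mul0mx mxE.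
pose W p := stereo p *m J.
have uW p : unit_perp (W p).
  split; last exact: perpJ.
  by have [h _ _ _] := stereo_frame p; rewrite dotrv_mul.
have W0 : W (0, 0) = w0.
  have -> : W (0, 0) = row_mx (0 : 'rV[R]_2) (1%:M : 'rV[R]_1) *m J.
    congr (_ *m J); rewrite /stereo /= expr0n /= !addr0 invr1 scale1r mulr0 subr0.
    apply/rowP => i; rewrite !mxE; case: splitP => j ->.
      by rewrite mxE; case: j => -[|[|]].
    by rewrite ord1 mxE.
  by rewrite mul_row_col mul0mx mul1mx add0r.
have [Phi mPhi] := choice (fun p => motion_exists (uW p)).
have estereo := econt_stereo (R := R).
have eW : econt W by apply: econt_mul => //; exact: econt_cst.
have cPhi : continuous Phi.
  apply: (@closed_graph_continuous _ _ _ (snd @` motion_graph)).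
  - exact: norm_hausdorff.
  - apply: continuous_compact compact_motion_graph.
    by apply: continuous_subspaceT => q; exact: cvg_snd.
  - by move=> p; exists (W p, Phi p) => //; split; [exact: uW|exact: mPhi].
  have -> : [set q : (R * R) * 'M[R]_5 | q.2 = Phi q.1] =
      [set q | motion_graph (W q.1, q.2)].
    apply/seteqP; split=> [[p P] /= ->|[p P] /= [_ mP]].
      by split; [exact: uW|exact: mPhi].
    exact: motion_unique (uW p) mP (mPhi p).
  apply: closed_preimage closed_motion_graph; apply: cont_pair; last exact: cont_snd.
  by apply: cont_comp (econt_continuous eW); exact: cont_fst.
pose M p := J *m Phi p *m J^T.
have [p [p1 p2]] : exists p, umbilic_re (M p) p = 0 /\ umbilic_im (M p) p = 0.
  apply: umbilic_exists.
    apply: econt_mul; last exact: econt_cst.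
    by apply: econt_mul; [exact: econt_cst|exact: continuous_econt].
  move=> q q1; rewrite /M; suff -> : Phi (- q.1, - q.2) = Phi q by [].
  apply: (motion_unique (uW q)) (mPhi q).
  have -> : W q = - W (- q.1, - q.2).
    rewrite /W -mulNmx; congr (_ *m J); rewrite /stereo /= !sqrrN q1.
    apply/rowP => -[[|[|[|//]]] hj]; rewrite !mxE /=; ring.
  exact: motion_opp.
have bilJ f g : bil (M p) f g = bil (Phi p) (f *m J) (g *m J).
  by rewrite /bil /M !dotrvE trmx_mul !mulmxA.
move: p1 p2; rewrite /umbilic_re /umbilic_im !bilJ => p1 p2.
have [ss f11 f22 [sf1 sf2 f12]] := stereo_frame p.
have [PP dP wP eP E] := mPhi p.
have perp_e f : dotrv e (f *m J) = 0 by exact: perpJ.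
have perp_x f : dotrv (f *m J) x = 0 by rewrite dotrvC; exact: perpJ.
have xP : x *m Phi p = Phi p 0 0 *: x.
  apply: (@umbilic_fix _ e (W p) (frame1 p *m J) (frame2 p *m J)) => //;
    rewrite ?dotrv_mul ?e5e5//.
  - exact: perp_e.
  - exact: perp_x.
  - by apply/eqP; rewrite -subr_eq0 p1.
have signE : Phi p 0 0 = P0 0 0.
  have <- : Phi (0, 0) = P0.
    by apply: (motion_unique uw0) m0; have := mPhi (0, 0); rewrite W0.
  have cS : continuous (fun r : R => Phi (r * p.1, r * p.2) 0 0).
    apply: (cont_comp (g := fun q => Phi q 0 0)); last exact: (continuous_econt cPhi).
    by apply: cont_pair; cont.
  have := @locally_constant_itv R (fun r => Phi (r * p.1, r * p.2) 0 0 = Phi (0, 0) 0 0) _.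
  rewrite !mul1r !mul0r; case: p {p1 p2 bilJ ss f11 f22 sf1 sf2 f12 PP dP wP eP E xP} cS.
  move=> a b /= cS; apply => // r.
  have := cS r; rewrite /continuous_at => /cvgrPdist_lt /(_ 1 ltr01).
  apply: filterS => r'.
  have [-> | ->] := motion_sign (mPhi (r * a, r * b));
  have [-> | ->] := motion_sign (mPhi (r' * a, r' * b)) => //;
  rewrite ?opprK ltr_norml; lra.
have cw : dotrv (s *: e + t *: x) (W p) = 0.
  by rewrite dotrvDl !dotrvZl perp_e dotrvC perp_x !mulr0 addr0.
have cP : (s *: e + t *: x) *m Phi p = P0 0 0 *: (s *: e + t *: x).
  by rewrite mulmxDl -!scalemxAl eP xP signE scalerDr !scalerA ![P0 0 0 * _]mulrC.
by rewrite E// signE cP.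
Qed.

End Frame5.
End FiveDim.

(** * Conclusion *)

(** Only [zeta], [p] and [q] have to lie in the span of the first three rows,
    which leaves room for [w0]. *)
Lemma adapted_frame (R : realType) n (zeta p q : 'rV[R]_n) : (5 <= n)%N ->
  enorm zeta = 1 ->
  exists (B : 'M[R]_(5, n)) (w0 p' q' : 'rV[R]_5),
   [/\ B *m B^T = 1%:M, e5 R *m B = zeta, unit_perp w0 &
     [/\ dotrv p' w0 = 0, dotrv q' w0 = 0, p = p' *m B & q = q' *m B]].
Proof.
move=> n5 z1.
have zz : zeta *m zeta^T = 1%:M.
  by rewrite mulmx_tr_dotrv -[dotrv _ _]sqr_sqrtr ?dotrv_ge0// -/(enorm _) z1 expr1n.
have [C [CC zC [X [Y XY]]]] := @orthonormal_extend R 2 1 n zeta (col_mx p q) zz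
  (ltac:(by apply: leq_trans n5)).
pose A1 : 'M[R]_(1 + 2, n) := col_mx zeta C.
have A1O : A1 *m A1^T = 1%:M.
  rewrite tr_col_mx mul_col_row zz CC zC.
  have -> : C *m zeta^T = 0 by apply: trmx_inj; rewrite trmx_mul trmxK zC trmx0.
  by rewrite -scalar_mx_block.
have [D [DD A1D _]] := @orthonormal_extend R 2 (1 + 2) n A1 0 A1O n5.
pose B : 'M[R]_(1 + 2 + 2, n) := col_mx A1 D.
have BB : B *m B^T = 1%:M.
  rewrite tr_col_mx mul_col_row A1O DD A1D.
  have -> : D *m A1^T = 0 by apply: trmx_inj; rewrite trmx_mul trmxK A1D trmx0.
  by rewrite -scalar_mx_block.
pose w0 : 'rV[R]_(1 + 2 + 2) := row_mx 0 (delta_mx 0 0).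
pose emb (u : 'rV[R]_(1 + 2)) : 'rV[R]_(1 + 2 + 2) := row_mx u 0.
have embB u : emb u *m B = u *m A1 by rewrite mul_row_col mul0mx addr0.
have dot0 u : dotrv (emb u) w0 = 0.
  by rewrite dotrvE tr_row_mx mul_row_col trmx0 mulmx0 mul0mx addr0 mxE.
have w0w0 : dotrv w0 w0 = 1.
  rewrite dotrvE tr_row_mx mul_row_col mul0mx add0r trmx_delta mul_delta_mx.
  by rewrite mxE !eqxx.
have eE : e5 R = emb (row_mx 1%:M 0).
  apply/rowP => i; rewrite !mxE eqxx /=; case: splitP => j /= ij.
    rewrite mxE; case: splitP => k /= jk; rewrite mxE.
      by rewrite (ord1 k) in jk *; rewrite -val_eqE /= ij jk eqxx.
    by rewrite -val_eqE /= ij jk.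
  by rewrite mxE -val_eqE /= ij.
pose X' : 'M[R]_(1 + 1, 1) := X; pose Y' : 'M[R]_(1 + 1, 2) := Y.
have pq : col_mx p q = col_mx (usubmx X' *m zeta + usubmx Y' *m C)
    (dsubmx X' *m zeta + dsubmx Y' *m C).
  by rewrite -add_col_mx -!mul_col_mx !vsubmxK.
have [pE qE] := eq_col_mx pq.
exists B, w0.
exists (emb (row_mx (usubmx X') (usubmx Y'))).
exists (emb (row_mx (dsubmx X') (dsubmx Y'))).
split => //; first by rewrite eE embB mul_row_col mul1mx mul0mx addr0.
  by split => //; rewrite eE.
by split; rewrite ?embB ?mul_row_col.
Qed.

Lemma perp_plane (R : realType) (w0 p : 'rV[R]_5) : unit_perp w0 -> dotrv p w0 = 0 ->
  exists s t x, [/\ unit_perp x, dotrv x w0 = 0 & p = s *: e5 R + t *: x].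
Proof.
move=> [ww ew] pw; pose A : 'M[R]_(1 + 1, 5) := col_mx (e5 R) w0.
have AA : A *m A^T = 1%:M.
  rewrite tr_col_mx mul_col_row !mulmx_tr_dotrv (dotrvC w0) e5e5 ww ew.
  have z0 : (0 : R)%:M = 0 :> 'M[R]_1 by rewrite -scalemx1 scale0r.
  by rewrite z0 -scalar_mx_block.
have [v [vv Av [y [c pE]]]] := orthonormal_step p AA (isT : (1 + 1 < 5)%N).
move: Av; rewrite mul_col_mx => /eqP; rewrite col_mx_eq0 !mulmx_tr_dotrv.
move=> /andP[/eqP/matrixP/(_ 0 0) ev /eqP/matrixP/(_ 0 0) wv].
move: ev wv (congr1 (fun M : 'M[R]_1 => M 0 0) vv).
rewrite mulmx_tr_dotrv !mxE !mulr1n => ev wv v1.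
move: pE; rewrite -[y]hsubmxK mul_row_col [lsubmx y]mx11_scalar [rsubmx y]mx11_scalar.
rewrite !mul_scalar_mx; set s := lsubmx y 0 0; set r := rsubmx y 0 0 => pE.
have r0 : r = 0.
  move: pw; rewrite pE !dotrvDl !dotrvZl ew ww (dotrvC v) wv !mulr0 mulr1.
  by rewrite add0r addr0.
exists s, c, v; split => //; first by rewrite dotrvC.
by rewrite pE r0 scale0r addr0.
Qed.

Theorem corollary2 (R : realType) (n : nat) (hn : (5 <= n)%N)
    (K L : set 'rV[R]_n)
    (hK : star_body K) (hL : star_body L)
    (hKd : countable (diameters K)) (hLd : countable (diameters L))
    (zeta : 'rV[R]_n) (hzeta : enorm zeta = 1)
    (hdiam : has_diameter_along K zeta)
    (hcongr : forall H : {vspace 'rV[R]_n}, \dim H = 4%N -> zeta \in H ->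
       directly_congruent H (section_by K H) (section_by L H))
    (hSO4 : forall H : {vspace 'rV[R]_n}, \dim H = 4%N -> zeta \in H ->
       ~ has_SO_symmetry H (section_by K H) /\
       ~ has_SO_symmetry H (section_by L H))
    (hO3 : forall H : {vspace 'rV[R]_n}, \dim H = 4%N -> zeta \in H ->
       let H3 := (H :&: orth_hyperplane zeta)%VS in
       ~ has_O_symmetry H3 (section_by K H3) /\
       ~ has_O_symmetry H3 (section_by L H3)) :
  exists b : 'rV[R]_n, parallel b zeta /\
    (K = translate L b \/ K = translate (reflect0 L) b).
Proof.
have noK H dH zH := proj1 (hSO4 H dH zH).
have [al [d [d0 Kaxis Kdiam]]] := diameter_axis hK hzeta hdiam.
have Ldiam a b : segment a b `<=` L -> enorm (a - b) <= d.
  have [B [w0 [p [q [BB eB uw [pw qw -> ->]]]]]] := adapted_frame a b hn hzeta.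
  exact: (chord_le5 hcongr Kdiam BB eB uw pw qw).
have [la Llow] := axis_chord_unique hL hzeta d0 Ldiam.
pose shift_of ep := ep * (al + d / 2) - (la + d / 2).
have two_points p q : exists2 ep, ep = 1 \/ ep = -1 &
    (K p <-> L (ep *: p - shift_of ep *: zeta)) /\
    (K q <-> L (ep *: q - shift_of ep *: zeta)).
  have [B [w0 [p' [q' [BB eB uw [pw qw -> ->]]]]]] := adapted_frame p q hn hzeta.
  have [P0 mP0] := motion_exists hK hL hcongr hLd d0 Kaxis Llow BB eB Ldiam uw.
  exists (P0 0 0); first exact: motion_sign mP0.
  have onplane c : dotrv c w0 = 0 -> K (c *m B) <->
      L (P0 0 0 *: (c *m B) - shift_of (P0 0 0) *: zeta).
    move=> cw; have [s [t [x [ux xw ->]]]] := perp_plane uw cw.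
    rewrite -eB !scalemxAl -mulmxBl.
    exact: (plane_sections hK hL hcongr noK hLd d0 Kaxis Llow BB eB Ldiam
      uw ux xw mP0).
  by split; exact: onplane.
have [Kp|Kp] := pselect (forall p, K p <-> L (1 *: p - shift_of 1 *: zeta)).
  exists (shift_of 1 *: zeta); split; first by exists (shift_of 1).
  left; apply/seteqP; split=> [x /Kp Lx|_ [x Lx <-]].
    by exists (x - shift_of 1 *: zeta); rewrite ?subrK// -{1}[x]scale1r.
  by apply/Kp; rewrite scale1r addrK.
have [Kq|Kq] := pselect (forall p, K p <-> L (-1 *: p - shift_of (-1) *: zeta)).
  exists ((- shift_of (-1)) *: zeta); split; first by exists (- shift_of (-1)).
  right; apply/seteqP; split=> [x /Kq Lx|_ [_ [x Lx <-] <-]].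
    exists (x + shift_of (-1) *: zeta); last by rewrite scaleNr addrK.
    by exists (-1 *: x - shift_of (-1) *: zeta); rewrite // scaleN1r opprB addrC opprK.
  by apply/Kq; rewrite scaleN1r opprD opprK scaleNr opprK addrK.
(* each sign fails at some point, but p and q share a sign *)
exfalso; move/existsNP: Kp => [p Kp]; move/existsNP: Kq => [q Kq].
by have [ep [] -> []] := two_points p q.
Qed.
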